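(* (i) Let $M(g,\varrho)$ be a simple $\mathfrak{D}(G)$-module. Then the head $\mathsf{L}(g,\varrho)$ of the Verma module $\mathsf{M}(g,\varrho)$ is the unique (up to isomorphism) simple highest-weight $\mathfrak{D}$-module of weight $(g,\varrho)$. (ii) Every simple $\mathfrak{D}$-module is isomorphic to $\mathsf{L}(g,\varrho)$ for a unique (up to isomorphism) simple $\mathfrak{D}(G)$-module $M(g,\varrho)$.
   Context: Throughout, $\Bbbk$ is an algebraically closed field of characteristic zero, $G$ is a finite non-abelian group, and $V$ is a (left-left) Yetter–Drinfeld module over $\Bbbk G$ whose Nichols algebra $\mathfrak{B}(V)=\bigoplus_{n\ge 0}\mathfrak{B}^n(V)$ is finite-dimensional. Modules are left modules. For a finite-dimensional Hopf algebra $H$, the Drinfeld double is $H\otimes H^*$ as a coalgebra, with multiplication $(h\otimes f)(h'\otimes f')=\langle f_{(1)},h'_{(1)}\rangle\langle f_{(3)},\mathcal{S}(h'_{(3)})\rangle\,(hh'_{(2)}\otimes f'f_{(2)})$; it contains $H$ and $H^{*op}$ as Hopf subalgebras. $\mathfrak{D}(G)$ is the Drinfeld double of $\Bbbk G$, and $\mathfrak{D}$ is the Drinfeld double of the bosonization $\mathfrak{B}(V)\#\Bbbk G$. Let $\Bbbk^G=(\Bbbk G)^*$ with basis $\{\delta_h\}$ dual to $G$. Let $\overline V$ be $V^*$ with the Yetter–Drinfeld structure over $\Bbbk^G$ given by $\langle f\cdot y,x\rangle=\langle f,\mathcal{S}(x_{(-1)})\rangle\langle y,x_{(0)}\rangle$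 and $\langle y,g\cdot x\rangle=\langle y_{(-1)},g\rangle\langle y_{(0)},x\rangle$. One identifies $(\mathfrak{B}(V)\#\Bbbk G)^{*op}$ with $\mathfrak{B}(\overline V)\#\Bbbk^G$ (as graded Hopf algebras; $f\in\Bbbk^G$ acts as a functional on $\mathfrak{B}^0(V)\#\Bbbk G$ by $\langle f,g\rangle$ and vanishes in other degrees; $y\in\overline V$ acts by $x\#g\mapsto\langle y,x\rangle$ on $V\#\Bbbk G$ and vanishes in other degrees). Inside $\mathfrak{D}$, the subalgebra generated by $\Bbbk G$ and $\Bbbk^G$ is $\mathfrak{D}(G)$, and multiplication gives a linear isomorphism $\mathfrak{B}(V)\otimes\mathfrak{D}(G)\otimes\mathfrak{B}(\overline V)\to\mathfrak{D}$. $\mathfrak{D}^{\geq0}$ is the subalgebra generated by $\mathfrak{D}(G)$ and $\overline V$. Simple $\mathfrak{D}(G)$-modules: for $g\in G$ with centralizer $\mathcal{C}_g$ and an irreducible representation $(U,\varrho)$ of $\mathcal{C}_g$, $M(g,\varrho)=\Bbbk G\otimes_{\Bbbk\mathcal{C}_g}U$ with $f\cdot(x\otimes u)=\langle f,xgx^{-1}\rangle x\otimes u$ for $f\in\Bbbk^G$; every simple $\mathfrak{D}(G)$-module has this form. A $\mathfrak{D}(G)$-module is of weight $(g,\varrho)$ if it is isomorphic to $M(g,\varrho)$. $M(g,\varrho)$ is a $\mathfrak{D}^{\geq 0}$-module with $\overline V$ acting by zero. The Verma module is $\mathsf{M}(g,\varrho)=\mathfrak{D}\otimes_{\mathfrak{D}^{\geq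 0}}M(g,\varrho)$; it has a unique maximal $\mathfrak{D}$-submodule $\mathsf{X}(g,\varrho)$, and $\mathsf{L}(g,\varrho)=\mathsf{M}(g,\varrho)/\mathsf{X}(g,\varrho)$ is its head. A $\mathfrak{D}$-module $N$ is a highest-weight module of weight $(g,\varrho)$ if it is generated as a $\mathfrak{D}$-module by a simple $\mathfrak{D}(G)$-submodule $M\subseteq N$ of weight $(g,\varrho)$ with $\overline V M=0$. *)

(* Defs.v *)
From HB Require Import structures.
From mathcomp Require Import all_boot all_order all_algebra all_fingroup all_field.
From mathcomp Require Import all_character.
From mathcomp Require Import ring_quotient generic_quotient boolp.
From mathcomp.multinomials Require Import freeg.

Set Implicit Arguments.
Unset Strict Implicit.
Unset Printing Implicit Defensive.

Import GRing.Theory.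
Local Open Scope ring_scope.
Local Open Scope quotient_scope.

Section Submodules.
Variables (R : nzRingType) (N : lmodType R).

Definition gensub (X : N -> Prop) : {pred N} := fun x =>
  `[< forall P : {pred N},
        submod_closed P -> (forall y, X y -> y \in P) -> x \in P >].

Lemma gensub_submod X : submod_closed (gensub X).
Proof.
split=> [|a u v /asboolP Xu /asboolP Xv]; apply/asboolP=> P cP XP.
  by case: cP.
by apply: cP.2; [apply: Xu|apply: Xv].
Qed.

Lemma gensubP (X : N -> Prop) (P : {pred N}) :
  submod_closed P -> (forall y, X y -> y \in P) -> {subset gensub X <= P}.
Proof. by move=> cP XP x /asboolP; apply. Qed.

Lemma mem_gensub (X : N -> Prop) x : X x -> x \in gensub X.
Proof. by move=> Xx; apply/asboolP=> P _; apply. Qed.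

Definition simple_sub (M : {pred N}) :=
  [/\ submod_closed M, exists2 x, x \in M & x != 0
    & forall P : {pred N}, submod_closed P -> {subset P <= M} ->
        {in P, forall x, x = 0} \/ {subset M <= P}].

Definition simple_module := simple_sub predT.

Definition maximal_sub (M : {pred N}) :=
  [/\ submod_closed M, exists x, x \notin M
    & forall P : {pred N}, submod_closed P -> {subset M <= P} ->
        {subset P <= M} \/ forall x, x \in P].

Definition module_rad : {pred N} := fun x =>
  `[< forall M : {pred N}, maximal_sub M -> x \in M >].

Lemma module_rad_submod : submod_closed module_rad.
Proof.
split=> [|a u v /asboolP ru /asboolP rv]; apply/asboolP=> M mM.
  by case: mM => [[]].
by case: (mM) => [[_ cM] _ _]; apply: cM; [apply: ru|apply: rv].
Qed.

Lemma module_rad_unique (M : {pred N}) :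
  maximal_sub M -> (forall M' : {pred N}, maximal_sub M' -> M' =i M) ->
  module_rad =i M.
Proof.
move=> maxM uniqM x; apply/asboolP/idP => [|Mx M' maxM']; first exact.
by rewrite (uniqM M').
Qed.

End Submodules.

Definition lmod_iso (R : nzRingType) (N N' : lmodType R) :=
  exists f : {linear N -> N'}, bijective f.

Section QuotientModule.
Variables (R : nzRingType) (N : lmodType R).
Variables (P : {pred N}) (cP : submod_closed P).

Definition quotsub of submod_closed P : {pred N} := P.
Let S := quotsub cP.
HB.instance Definition _ :=
  GRing.isZmodClosed.Build N S (GRing.submod_closedB cP).

Definition quotmod : Type := Quotient.quot S.
HB.instance Definition _ := GRing.Zmodule.on quotmod.

Definition quotpi (x : N) : quotmod := \pi_(Quotient.quot S) x.

Definition quotrepr (x : quotmod) : N := repr (x : Quotient.quot S).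

Lemma quotpiP x y : (quotpi x = quotpi y) <-> (x - y \in P).
Proof. by rewrite -[_ \in P]/(_ \in S) Quotient.idealrBE; split=> /eqP. Qed.

Lemma quotpi0 : quotpi 0 = 0.
Proof. exact: (raddf0 \pi_(Quotient.quot S)). Qed.

Lemma quotreprK : cancel quotrepr quotpi.
Proof. exact: reprK. Qed.

Lemma quotpiD : {morph quotpi : x y / x + y}.
Proof. exact: (raddfD \pi_(Quotient.quot S)). Qed.

(* P-stable endomaps of N descend to N / P. *)
Section Lift.
Variable f : {additive N -> N}.
Hypothesis fP : {homo f : x / x \in P}.
Definition quotlift (x : quotmod) : quotmod := quotpi (f (quotrepr x)).
Lemma quotliftE x : quotlift (quotpi x) = quotpi (f x).
Proof.
by apply/quotpiP; rewrite -raddfB; apply/fP/quotpiP; rewrite quotreprK.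
Qed.
End Lift.

Let submodZ a x : x \in P -> a *: x \in P.
Proof. by move=> Px; rewrite -[_ *: _]addr0 cP.2 ?cP.1. Qed.

Definition quot_scale (a : R) (x : quotmod) : quotmod :=
  quotpi (a *: quotrepr x).

Lemma quot_scaleE a x : quot_scale a (quotpi x) = quotpi (a *: x).
Proof.
apply/quotpiP; rewrite -scalerBr; apply/submodZ/quotpiP.
exact: quotreprK.
Qed.

Lemma quot_scaleA a b x : quot_scale a (quot_scale b x) = quot_scale (a * b) x.
Proof. by rewrite -[x]quotreprK !quot_scaleE scalerA. Qed.
Lemma quot_scale1 : left_id 1 quot_scale.
Proof. by move=> x; rewrite -[x]quotreprK !quot_scaleE scale1r. Qed.
Lemma quot_scaleDr : right_distributive quot_scale +%R.
Proof.
move=> a x y; rewrite -[x]quotreprK -[y]quotreprK -quotpiD !quot_scaleE.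
by rewrite scalerDr quotpiD.
Qed.
Lemma quot_scaleDl x : {morph quot_scale^~ x : a b / a + b}.
Proof.
by move=> a b; rewrite -[x]quotreprK !quot_scaleE scalerDl quotpiD.
Qed.
HB.instance Definition _ := GRing.Zmodule_isLmodule.Build R quotmod
  quot_scaleA quot_scale1 quot_scaleDr quot_scaleDl.

End QuotientModule.
Arguments quotpi {R N P} cP x.
Arguments quotlift {R N P} cP f x.

Definition module_head (R : nzRingType) (N : lmodType R) : lmodType R :=
  quotmod (@module_rad_submod R N).

(* N viewed as an A-module along A -> B. *)
Definition restr_along (A B : nzRingType) (phi : {rmorphism A -> B})
  (N : lmodType B) : Type := N.

Section ChangeOfRings.
Variables (A B : nzRingType) (phi : {rmorphism A -> B}).

Section Restr.
Variable N : lmodType B.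
Local Notation restr := (restr_along phi).
HB.instance Definition _ := GRing.Zmodule.on (restr N).
Definition restr_scale (a : A) (x : restr N) : restr N := phi a *: (x : N).
Lemma restr_scaleA a b x :
  restr_scale a (restr_scale b x) = restr_scale (a * b) x.
Proof. by rewrite /restr_scale scalerA rmorphM. Qed.
Lemma restr_scale1 : left_id 1 restr_scale.
Proof. by move=> x; rewrite /restr_scale rmorph1 scale1r. Qed.
Lemma restr_scaleDr : right_distributive restr_scale +%R.
Proof. by move=> a x y; rewrite /restr_scale scalerDr. Qed.
Lemma restr_scaleDl x : {morph restr_scale^~ x : a b / a + b}.
Proof. by move=> a b; rewrite /restr_scale rmorphD scalerDl. Qed.
HB.instance Definition _ := GRing.Zmodule_isLmodule.Build A (restr N)
  restr_scaleA restr_scale1 restr_scaleDr restr_scaleDl.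
End Restr.

(* B (x)_A M, as the free B-module on the set M (whose basis element m stands
   for 1 (x) m) modulo the additivity and A-balancing relations. *)
Section Induce.
Variable M : lmodType A.
Definition indfree : lmodType B := {freeg M / B}.
Definition indpure (b : B) (m : M) : indfree := << b *g m >>.
Definition indrel (z : indfree) : Prop :=
  (exists b m m', z = indpure b (m + m') - indpure b m - indpure b m') \/
  (exists b a m, z = indpure (b * phi a) m - indpure b (a *: m)).
Definition induce : lmodType B := quotmod (gensub_submod indrel).
End Induce.

End ChangeOfRings.

Section Span.
Variables (k : fieldType) (U : vectType k).

Lemma vspan_subproof (X : U -> Prop) :
  exists W : {vspace U}, (forall x, X x -> x \in W) /\
    forall W' : {vspace U}, (forall x, X x -> x \in W') -> (W <= W')%VS.
Proof.
pose Q n := `[< exists2 W : {vspace U}, forall x, X x -> x \in W & \dim W = n >].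
have exQ : exists n, Q n.
  exists (\dim {:U}); apply/asboolP; exists {:U}%VS; last by [].
  by move=> x _; rewrite memvf.
case: (ex_minnP exQ) => _ /asboolP[W XW <-] minW.
exists W; split=> // W' XW'; apply/capv_idPl/eqP.
rewrite eqEdim capvSl minW //; apply/asboolP; exists (W :&: W')%VS => // x Xx.
by rewrite memv_cap XW ?XW'.
Qed.

(* The linear span of a set of vectors. *)
Definition vspan (X : U -> Prop) : {vspace U} := sval (cid (vspan_subproof X)).

Lemma mem_vspan (X : U -> Prop) x : X x -> x \in vspan X.
Proof. by rewrite /vspan; case: cid => W [XW _] /=; apply: XW. Qed.

Lemma vspan_sub (X : U -> Prop) (W : {vspace U}) :
  (forall x, X x -> x \in W) -> (vspan X <= W)%VS.
Proof. by rewrite /vspan; case: cid => ? [_ minW] /=; apply: minW. Qed.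

End Span.

Section Tensor.
Variable k : fieldType.

(* U (x) W, in coordinates with respect to the library's bases of U and W. *)
Definition tens (U W : vectType k) : vectType k :=
  'M[k]_(\dim {:U}, \dim {:W}).

Definition tpure (U W : vectType k) (u : U) (w : W) : tens U W :=
  \matrix_(i, j) (coord (vbasis {:U}) i u * coord (vbasis {:W}) j w).

(* The linear map U (x) W -> X induced by a bilinear b. *)
Definition tlift (U W X : vectType k) (b : U -> W -> X) (t : tens U W) : X :=
  \sum_i \sum_j t i j *: b (vbasis {:U})`_i (vbasis {:W})`_j.

Definition tensv (U W : vectType k) (U1 : {vspace U}) (W1 : {vspace W}) :
  {vspace tens U W} :=
  vspan (fun t => exists u w, [/\ u \in U1, w \in W1 & t = tpure u w]).

End Tensor.

(* Sweedler notation: for t = t' (x) t'', tsum t b is b(t', t''). *)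
Notation tsum t b := (tlift b t) (only parsing).

Section TensorTheory.
Variables (k : fieldType).

Lemma tpureDl (U W : vectType k) (a : k) (u u' : U) (w : W) :
  tpure (a *: u + u') w = a *: tpure u w + tpure u' w.
Proof. by apply/matrixP=> i j; rewrite !mxE linearP mulrDl mulrA. Qed.

Lemma tpureDr (U W : vectType k) (a : k) (u : U) (w w' : W) :
  tpure u (a *: w + w') = a *: tpure u w + tpure u w'.
Proof. by apply/matrixP=> i j; rewrite !mxE linearP mulrDr mulrCA. Qed.

Lemma tlift_is_linear (U W X : vectType k) (b : U -> W -> X) :
  linear (tlift b : tens U W -> X).
Proof.
move=> a s t; rewrite /tlift scaler_sumr -big_split; apply: eq_bigr => i _ /=.
rewrite scaler_sumr -big_split; apply: eq_bigr => j _ /=.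
by rewrite !mxE scalerDl scalerA.
Qed.
HB.instance Definition _ (U W X : vectType k) (b : U -> W -> X) :=
  GRing.isLinear.Build k (tens U W) X _ (tlift b) (tlift_is_linear b).

Lemma tlift_pure (U W X : vectType k) (b : U -> W -> X) u w :
  (forall w, linear (b^~ w)) -> (forall u, linear (b u)) ->
  tlift b (tpure u w) = b u w.
Proof.
move=> bl br.
pose bL w := GRing.isLinear.Build _ _ _ _ _ (bl w).
pose fL w : {linear U -> X} := HB.pack (b^~ w) (bL w).
pose bR u := GRing.isLinear.Build _ _ _ _ _ (br u).
pose fR u : {linear W -> X} := HB.pack (b u) (bR u).
rewrite [in RHS](coord_vbasis (memvf u)).
rewrite -[RHS]/(fL w _) linear_sum /tlift; apply: eq_bigr => i _.
rewrite linearZ /= [in RHS](coord_vbasis (memvf w)) -[b _ _]/(fR _ _).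
rewrite linear_sum scaler_sumr; apply: eq_bigr => j _.
by rewrite linearZ /= mxE scalerA.
Qed.

End TensorTheory.

Section Coalgebra.
Variables (k : fieldType) (C : vectType k).
Variables (D : 'Hom(C, tens C C)) (e : 'Hom(C, k^o)).

Definition is_coalgebra : Prop :=
  [/\ forall c, tsum (D c) (fun a b => tsum (D a) (fun a1 a2 =>
                  tpure a1 (tpure a2 b)))
              = tsum (D c) (fun a b => tpure a (D b)),
      forall c, tsum (D c) (fun a b => (e a : k) *: b) = c
    & forall c, tsum (D c) (fun a b => (e b : k) *: a) = c].
End Coalgebra.

Definition is_antipode (k : fieldType) (A : falgType k)
    (D : 'Hom(A, tens A A)) (e : 'Hom(A, k^o)) (S : 'End(A)) : Prop :=
  forall a, tsum (D a) (fun x y => S x * y) = (e a : k)%:A /\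
            tsum (D a) (fun x y => x * S y) = (e a : k)%:A.

Record hopf (k : fieldType) (H : falgType k) := Hopf {
  hcop : 'Hom(H, tens H H);
  hcou : 'Hom(H, k^o);
  hant : 'End(H);
  hopf_coalg : is_coalgebra hcop hcou;
  hcop1 : hcop 1 = tpure 1 1;
  hcopM : forall a b : H, hcop (a * b) =
    tsum (hcop a) (fun a1 a2 => tsum (hcop b) (fun b1 b2 =>
      tpure (a1 * b1) (a2 * b2)));
  hcou1 : hcou 1 = 1;
  hcouM : forall a b : H, hcou (a * b) = (hcou a * hcou b : k);
  hantP : is_antipode hcop hcou hant }.

(* Yetter-Drinfeld modules over kG. As kG (x) V has basis G over V, a coaction
   V -> kG (x) V is a family of endomorphisms ycoact g, g in G:
   v_(-1) (x) v_(0) = \sum_g g (x) ycoact g v. *)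
Record ydMod (k : fieldType) (gT : finGroupType) (V : vectType k) := YDMod {
  yact : gT -> 'End(V);
  ycoact : gT -> 'End(V);
  yact1 : forall v, yact 1%g v = v;
  yactM : forall x y v, yact (x * y)%g v = yact x (yact y v);
  ycoactK : forall g h v,
    ycoact g (ycoact h v) = if g == h then ycoact g v else 0;
  ycoact_sum : forall v, \sum_g ycoact g v = v;
  yd_compat : forall g h v,
    ycoact (h * g * h^-1)%g (yact h v) = yact h (ycoact g v) }.

Section YDTensor.
Variables (k : fieldType) (gT : finGroupType).

Definition tens_act (B : vectType k) (Y : ydMod gT B) g (t : tens B B) :
  tens B B := tsum t (fun a b => tpure (yact Y g a) (yact Y g b)).

Definition tens_coact (B : vectType k) (Y : ydMod gT B) g (t : tens B B) :
  tens B B := tsum t (fun a b =>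
    \sum_(h : gT) tpure (ycoact Y h a) (ycoact Y (h^-1 * g)%g b)).

(* (a (x) b) (a' (x) b') = a (b_(-1) . a') (x) b_(0) b'. *)
Definition braided_mul (B : falgType k) (Y : ydMod gT B) (s t : tens B B) :
  tens B B := tsum s (fun a b => tsum t (fun a' b' =>
    \sum_(g : gT) tpure (a * yact Y g a') (ycoact Y g b * b'))).

End YDTensor.

(* B is the Nichols algebra of V: a graded Hopf algebra in the category of
   Yetter-Drinfeld modules with B^0 = k, with B^1 isomorphic to V and equal to
   the space of primitive elements, and generated by B^1. *)
Record nichols (k : fieldType) (gT : finGroupType) (V : vectType k)
    (Y : ydMod gT V) (B : falgType k) := Nichols {
  nyd : ydMod gT B;
  ndeg : nat -> {vspace B};
  ncop : 'Hom(B, tens B B);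
  ncou : 'Hom(B, k^o);
  nant : 'End(B);
  nincl : 'Hom(V, B);
  ndeg_direct : forall m, directv (\sum_(i < m) ndeg i);
  ndeg_full : exists m, (\sum_(i < m) ndeg i = {:B})%VS;
  ndegM : forall i j a b,
    a \in ndeg i -> b \in ndeg j -> a * b \in ndeg (i + j)%N;
  ndeg_act : forall i g a, a \in ndeg i -> yact nyd g a \in ndeg i;
  ndeg_coact : forall i g a, a \in ndeg i -> ycoact nyd g a \in ndeg i;
  ndeg_cop : forall m a, a \in ndeg m ->
    ncop a \in (\sum_(i < m.+1) tensv (ndeg i) (ndeg (m - i)%N))%VS;
  ndeg_cou : forall m a, a \in ndeg m -> (0 < m)%N -> ncou a = 0;
  nact1 : forall g, yact nyd g 1 = 1;
  nactM : forall g a b, yact nyd g (a * b) = yact nyd g a * yact nyd g b;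
  ncoact1 : ycoact nyd 1%g 1 = 1;
  ncoactM : forall g a b, ycoact nyd g (a * b) =
    \sum_(h : gT) ycoact nyd h a * ycoact nyd (h^-1 * g)%g b;
  nichols_coalg : is_coalgebra ncop ncou;
  ncop_act : forall g a, ncop (yact nyd g a) = tens_act nyd g (ncop a);
  ncop_coact : forall g a, ncop (ycoact nyd g a) = tens_coact nyd g (ncop a);
  ncou_act : forall g a, ncou (yact nyd g a) = ncou a;
  ncou_coact : forall g a,
    ncou (ycoact nyd g a) = if g == 1%g then ncou a else 0;
  ncop1 : ncop 1 = tpure 1 1;
  ncopM : forall a b, ncop (a * b) = braided_mul nyd (ncop a) (ncop b);
  ncou1 : ncou 1 = 1;
  ncouM : forall a b, ncou (a * b) = (ncou a * ncou b : k);
  nantP : is_antipode ncop ncou nant;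
  nincl_inj : injective nincl;
  nincl_act : forall g v, nincl (yact Y g v) = yact nyd g (nincl v);
  nincl_coact : forall g v, nincl (ycoact Y g v) = ycoact nyd g (nincl v);
  ndeg0 : ndeg 0%N = 1%VS;
  ndeg1 : ndeg 1%N = limg nincl;
  ndeg1_prim : forall b,
    b \in ndeg 1%N <-> ncop b = tpure b 1 + tpure 1 b;
  ndeg1_gen : agenv (ndeg 1%N) = {:B}%VS }.

(* H is the bosonization B # kG; b # g is bos_alg b * bos_grp g. *)
Record bosonization (k : fieldType) (gT : finGroupType) (V : vectType k)
    (Y : ydMod gT V) (B : falgType k) (NB : nichols Y B)
    (H : falgType k) (hH : hopf H) := Bosonization {
  bos_alg : 'AHom(B, H);
  bos_grp : gT -> H;
  bos_bij : bijective (fun b : {ffun gT -> B} =>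
              \sum_g bos_alg (b g) * bos_grp g);
  bos_grp1 : bos_grp 1%g = 1;
  bos_grpM : forall x y, bos_grp (x * y)%g = bos_grp x * bos_grp y;
  bos_comm : forall g b,
    bos_grp g * bos_alg b = bos_alg (yact (nyd NB) g b) * bos_grp g;
  bos_cop_grp : forall g, hcop hH (bos_grp g) = tpure (bos_grp g) (bos_grp g);
  bos_cou_grp : forall g, hcou hH (bos_grp g) = 1;
  bos_cop_alg : forall b, hcop hH (bos_alg b) =
    tsum (ncop NB b) (fun b1 b2 => \sum_(g : gT)
      tpure (bos_alg b1 * bos_grp g) (bos_alg (ycoact (nyd NB) g b2)));
  bos_cou_alg : forall b, hcou hH (bos_alg b) = ncou NB b }.

Section Dual.
Variables (k : fieldType) (H : falgType k) (hH : hopf H).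

Local Notation dual := 'Hom(H, k^o).

Definition dual_mul (f f' : dual) : dual :=
  (linfun (tlift (fun a b : H => f a * f' b : k^o))
     \o hcop hH)%VF.

(* <f_(1), a> <f_(3), c> f_(2), that is, x |-> f (a x c). *)
Definition dual_hit (a : H) (f : dual) (c : H) : dual :=
  (f \o amulr c \o amull a)%VF.

End Dual.

(* D is the algebra underlying the Drinfeld double of H: dd identifies H (x) H^*
   with D, and ddM is the multiplication rule of the double. *)
Record drinfeldDouble (k : fieldType) (H : falgType k) (hH : hopf H)
    (D : falgType k) := DrinfeldDouble {
  dd : 'Hom(tens H 'Hom(H, k^o), D);
  dd_bij : bijective dd;
  dd1 : dd (tpure 1 (hcou hH : 'Hom(H, k^o))) = 1;
  ddM : forall (h h' : H) (f f' : 'Hom(H, k^o)),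
    dd (tpure h f) * dd (tpure h' f') =
    tsum (hcop hH h') (fun h'12 h'3 => tsum (hcop hH h'12) (fun h'1 h'2 =>
      dd (tpure (h * h'2)
            (dual_mul hH f' (dual_hit h'1 f (hant hH h'3)))))) }.

Section DoubleModules.
Variables (k : fieldType) (gT : finGroupType).
Variables (V : vectType k) (YV : ydMod gT V).
Variables (B : falgType k) (NB : nichols YV B).
Variables (H : falgType k) (hH : hopf H) (bH : bosonization NB hH).
Variables (D : falgType k) (dD : drinfeldDouble hH D).

Local Notation Hd := 'Hom(H, k^o).
Local Notation grp := (bos_grp bH).

Definition dd_alg (h : H) : D := dd dD (tpure h (hcou hH : Hd)).
Definition dd_dual (f : Hd) : D := dd dD (tpure 1 f).

(* The functionals on H that come from k^G and from \overline V. *)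
Definition in_dualG (f : Hd) : Prop :=
  forall m b g, b \in ndeg NB m -> m != 0%N -> f (bos_alg bH b * grp g) = 0.

Definition in_Vbar (y : Hd) : Prop :=
  (forall m b g, b \in ndeg NB m -> m != 1%N -> y (bos_alg bH b * grp g) = 0) /\
  (forall v g, y (bos_alg bH (nincl NB v) * grp g)
             = y (bos_alg bH (nincl NB v))).

Definition DG_gens (d : D) : Prop :=
  (exists g, d = dd_alg (grp g)) \/ (exists2 f, in_dualG f & d = dd_dual f).

Definition Dge0_gens (d : D) : Prop :=
  DG_gens d \/ (exists2 y, in_Vbar y & d = dd_dual y).

Section SubalgebraGenerated.
Variable X : D -> Prop.
Definition subalg : {aspace D} := agenv_aspace (vspan X).

Lemma subalg1 : 1 \in subalg.
Proof. by have := sub1_agenv (vspan X); rewrite -memvE. Qed.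

Definition subalg_val : subvs_of subalg -> D := vsval.
Lemma subalg_val_is_additive : zmod_morphism subalg_val.
Proof. by move=> x y; rewrite /subalg_val raddfB. Qed.
Lemma subalg_val_is_mult : monoid_morphism subalg_val.
Proof. by split=> //; apply/eqP; rewrite [_ == _]algid_eq1; apply: subalg1. Qed.
HB.instance Definition _ := GRing.isZmodMorphism.Build (subvs_of subalg) D
  subalg_val subalg_val_is_additive.
HB.instance Definition _ := GRing.isMonoidMorphism.Build (subvs_of subalg) D
  subalg_val subalg_val_is_mult.
End SubalgebraGenerated.

Lemma subalg_gen (X : D -> Prop) d : X d -> d \in subalg X.
Proof. by move=> Xd; apply: (subvP (sub_agenv _)); apply: mem_vspan. Qed.

(* The linear map from the functions G -> H^* to D sending F to the sum over x
   of x (x) F x. Its image kG (x) H^* contains D(G) and D^{>= 0}. *)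
Definition dd_grp (F : {ffun gT -> Hd}) : D := \sum_x dd dD (tpure (grp x) (F x)).

Lemma dd_grp_is_linear : linear dd_grp.
Proof.
move=> a F F'; rewrite /dd_grp scaler_sumr -big_split; apply: eq_bigr => x _ /=.
by rewrite !ffunE tpureDr linearP.
Qed.
HB.instance Definition _ :=
  GRing.isLinear.Build k {ffun gT -> Hd} D _ dd_grp dd_grp_is_linear.

Lemma grp_indep (c : gT -> k) : \sum_x c x *: grp x = 0 -> c =1 fun=> 0.
Proof.
move=> c0 x; have inj := bij_inj (bos_bij bH).
have: [ffun x => (c x)%:A] = [ffun => 0] :> {ffun gT -> B}.
  apply: inj; transitivity (0 : H).
    rewrite -{}[RHS]c0; apply: eq_bigr => y _.
    by rewrite ffunE linearZ /= rmorph1 -scalerAl mul1r.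
  by rewrite big1 // => y _; rewrite ffunE linear0 mul0r.
move/ffunP/(_ x); rewrite !ffunE => /eqP.
by rewrite scaler_eq0 oner_eq0 orbF => /eqP.
Qed.

Lemma dd_grp_ker : lker (linfun dd_grp) == 0%VS.
Proof.
apply/lker0P => F F'; rewrite !lfunE /= => eqF.
suff: (-1) *: F' + F = 0.
  by move/eqP; rewrite scaleN1r addrC subr_eq0 => /eqP.
have: dd_grp ((-1) *: F' + F) = 0.
  by rewrite dd_grp_is_linear eqF scaleN1r addNr.
move: (_ + F) => {eqF F'} {}F.
rewrite /dd_grp -linear_sum /= -[X in _ = X](linear0 (dd dD)).
move/(bij_inj (dd_bij dD)) => F0; apply/ffunP=> x; rewrite ffunE.
rewrite (coord_vbasis (memvf (F x))) big1 // => j _.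
suff -> : coord (vbasis fullv) j (F x) = 0 by rewrite scale0r.
move: x; apply: grp_indep; set h := \sum_x _.
rewrite (coord_vbasis (memvf h)) big1 // => i _; rewrite /h.
move/matrixP/(_ i j): F0; rewrite summxE mxE => F0.
rewrite linear_sum /= [X in X *: _](_ : _ = 0) ?scale0r // -[RHS]F0.
by apply: eq_bigr => x _; rewrite linearZ /= mxE mulrC.
Qed.

Lemma dd_grpK : cancel dd_grp (linfun dd_grp)^-1%VF.
Proof. by move=> F; rewrite -[dd_grp F](lfunE (dd_grp)) lker0_lfunK ?dd_grp_ker. Qed.

Lemma bos_ant_grp x : hant hH (grp x) = grp x^-1.
Proof.
have [+ _] := hantP hH (grp x); rewrite bos_cop_grp bos_cou_grp tlift_pure; first last.
- by move=> u a v w; rewrite mulrDr scalerAr.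
- by move=> w a u v; rewrite linearP mulrDl scalerAl.
rewrite scale1r => /(congr1 ( *%R^~ (grp x^-1))).
by rewrite -mulrA -bos_grpM mulgV bos_grp1 mulr1 mul1r.
Qed.

(* The second tensor factor of (x (x) f) (y (x) f') for x, y in G. *)
Definition grp_twist (y : gT) (f f' : Hd) : Hd :=
  dual_mul hH f' (dual_hit (grp y) f (grp y^-1)).

Lemma dual_mulE (f f' : Hd) (h : H) :
  dual_mul hH f f' h = tsum (hcop hH h) (fun a b => f a * f' b : k^o).
Proof. by rewrite comp_lfunE lfunE. Qed.

Lemma dual_hitE (a : H) (f : Hd) (c h : H) : dual_hit a f c h = f (a * h * c).
Proof. by rewrite !comp_lfunE !lfunE. Qed.

Lemma grp_twistE y f f' z :
  grp_twist y f f' (grp z) = (f' (grp z) * f (grp (y * z * y^-1)%g) : k).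
Proof.
rewrite dual_mulE bos_cop_grp tlift_pure.
- by rewrite dual_hitE !bos_grpM.
- by move=> w a u v; rewrite linearP mulrDl -scalerAl.
- by move=> u a v w; rewrite linearP mulrDr -scalerAr.
Qed.

Lemma dual_mul_linr f : linear (dual_mul hH f).
Proof.
move=> a f1 f2; apply/lfunP=> h; rewrite add_lfunE scale_lfunE !dual_mulE.
rewrite /tlift scaler_sumr -big_split; apply: eq_bigr => i _ /=.
rewrite scaler_sumr -big_split; apply: eq_bigr => j _ /=.
rewrite add_lfunE scale_lfunE mulrDr scalerDr; congr (_ + _).
rewrite /GRing.scale /=.
have aux (c x y z : k) : z * (x * (c * y)) = c * (z * (x * y)).
  by rewrite (mulrCA x c y) (mulrCA z c).
exact: aux.
Qed.

Lemma ddM_grp x y f f' :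
  dd dD (tpure (grp x) f) * dd dD (tpure (grp y) f') =
  dd dD (tpure (grp (x * y)%g) (grp_twist y f f')).
Proof.
rewrite ddM bos_cop_grp tlift_pure; first last.
- move=> u a v w; rewrite /tlift scaler_sumr -big_split; apply: eq_bigr => i _ /=.
  rewrite scaler_sumr -big_split; apply: eq_bigr => j _ /=.
  rewrite scalerA mulrC -scalerA -scalerDr -linearP -tpureDr -dual_mul_linr.
  congr (_ *: dd dD (tpure _ (dual_mul _ _ _))); apply/lfunP=> h.
  by rewrite add_lfunE scale_lfunE !dual_hitE !linearP mulrDr -scalerAr linearP.
- by move=> w a u v; rewrite linearP; exact: tlift_is_linear.
rewrite bos_cop_grp tlift_pure.
- by rewrite bos_grpM bos_ant_grp.
- move=> w a u v; rewrite -linearP -tpureDr -dual_mul_linr.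
  congr (dd dD (tpure _ (dual_mul _ _ _))); apply/lfunP=> h.
  rewrite add_lfunE scale_lfunE !dual_hitE !mulrDl -!scalerAl linearP.
  by [].
- by move=> u a v w; rewrite -linearP -tpureDl mulrDr scalerAr.
Qed.

Definition grp_mul (F F' : {ffun gT -> Hd}) : {ffun gT -> Hd} :=
  [ffun z => \sum_x grp_twist (x^-1 * z)%g (F x) (F' (x^-1 * z)%g)].

Lemma dd_grpM F F' : dd_grp F * dd_grp F' = dd_grp (grp_mul F F').
Proof.
rewrite /dd_grp mulr_suml.
transitivity (\sum_x \sum_z dd dD (tpure (grp z)
   (grp_twist (x^-1 * z)%g (F x) (F' (x^-1 * z)%g)))); last first.
  rewrite exchange_big; apply: eq_bigr => z _; rewrite ffunE -linear_sum.
  congr (dd dD _); apply/matrixP=> i j; rewrite summxE !mxE linear_sum mulr_sumr.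
  by apply: eq_bigr => x _; rewrite mxE.
apply: eq_bigr => x _; rewrite mulr_sumr (reindex_inj (mulgI x^-1%g)) /=.
by apply: eq_bigr => z _; rewrite ddM_grp mulKVg.
Qed.

Definition dd_single (y : gT) (f : Hd) : {ffun gT -> Hd} :=
  [ffun x => if x == y then f else 0].

Lemma dd_grp_single y f : dd_grp (dd_single y f) = dd dD (tpure (grp y) f).
Proof.
rewrite /dd_grp (bigD1 y) //= ffunE eqxx big1 ?addr0 // => x /negPf.
rewrite ffunE => ->; rewrite -[RHS](linear0 (dd dD)); congr (dd dD _).
by apply/matrixP=> i j; rewrite !mxE linear0 mulr0.
Qed.

Lemma dd_grp1 : dd_grp (dd_single 1%g (hcou hH)) = 1.
Proof. by rewrite dd_grp_single bos_grp1 dd1. Qed.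

Lemma dd_algE y : dd_alg (grp y) = dd_grp (dd_single y (hcou hH)).
Proof. by rewrite dd_grp_single. Qed.

Lemma dd_dualE f : dd_dual f = dd_grp (dd_single 1%g f).
Proof. by rewrite dd_grp_single bos_grp1. Qed.

Section Weights.
Variables (g : gT) (n : nat) (rG : mx_representation k 'C[g]%g n).

(* kG (x) U as U-valued functions on G. The representation space U is the space
   of row vectors, on which matrices act from the right: as a left module it is
   c . u = u *m rG c^-1. *)
Definition kGU : lmodType k := {ffun gT -> 'rV[k]_n}.
Definition kGU_pure (x : gT) (u : 'rV[k]_n) : kGU :=
  [ffun y => if y == x then u else 0].

Definition kGU_rel (p : kGU) : Prop := exists x c u, c \in 'C[g]%g /\
  p = kGU_pure (x * c)%g u - kGU_pure x (u *m rG c^-1%g).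

Definition kGCU : lmodType k := quotmod (gensub_submod kGU_rel).

(* The action of \sum_x x (x) F x on M(g,rho): here f (x) u |-> <f, x g x^-1> x (x) u
   for f in H^* restricted to G, and then x acts by left translation. *)
Definition kGU_act (F : {ffun gT -> Hd}) (p : kGU) : kGU :=
  [ffun z => \sum_x F x (grp (x^-1 * z * g * z^-1 * x)%g) *: p (x^-1 * z)%g].

Lemma kGU_act_linear F : linear (kGU_act F).
Proof.
move=> a p q; apply/ffunP=> z; rewrite !ffunE scaler_sumr -big_split.
apply: eq_bigr => x _ /=.
by rewrite !ffunE scalerDr !scalerA mulrC.
Qed.
HB.instance Definition _ F := GRing.isLinear.Build k kGU kGU _
  (kGU_act F) (kGU_act_linear F).

Lemma kGU_act_pure F z u : kGU_act F (kGU_pure z u) =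
  \sum_x F x (grp (z * g * z^-1)%g) *: kGU_pure (x * z)%g u.
Proof.
apply/ffunP=> w; rewrite ffunE sum_ffunE; apply: eq_bigr => x _.
rewrite !ffunE -(can2_eq (mulKVg x) (mulKg x)).
case: eqP => [<-|]; last by rewrite !scaler0.
by rewrite invMg invgK !mulgA.
Qed.

Lemma kGU_act_stable F :
  {homo kGU_act F : p / p \in gensub kGU_rel}.
Proof.
move=> p; move: p; apply: (@gensubP _ _ _ [pred p | kGU_act F p \in gensub kGU_rel]).
  have [c0 cP] := gensub_submod kGU_rel.
  split=> [|a u v]; rewrite !inE ?linear0 ?linearP //; exact: cP.
move=> _ [x [c [u [cC ->]]]]; rewrite inE.
rewrite -scaleN1r addrC kGU_act_linear !kGU_act_pure scaleN1r addrC -sumrB.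
have [c0 cP] := gensub_submod kGU_rel.
apply: (big_ind (fun q => q \in gensub kGU_rel)) => // [p q Pp Pq|y _].
  by rewrite -[p]scale1r; apply: cP.
have -> : (x * c * g * (x * c)^-1 = x * g * x^-1)%g.
  by rewrite invMg !mulgA; congr (_ * _)%g; rewrite -(mulgA x) (cent1P cC) mulgA mulgK.
rewrite -scalerBr -[_ *: _]addr0; apply: cP => //.
by apply: mem_gensub; exists (y * x)%g, c, u; rewrite mulgA.
Qed.

Lemma kGU_actDl a F F' p : kGU_act (a *: F + F') p = a *: kGU_act F p + kGU_act F' p.
Proof.
apply/ffunP=> z; rewrite !ffunE scaler_sumr -big_split; apply: eq_bigr => x _ /=.
by rewrite !ffunE add_lfunE scale_lfunE scalerDl scalerA.
Qed.

Lemma kGU_actM F F' p : kGU_act (grp_mul F F') p = kGU_act F (kGU_act F' p).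
Proof.
apply/ffunP=> z; rewrite !ffunE.
transitivity (\sum_x \sum_w grp_twist (x^-1 * w)%g (F x) (F' (x^-1 * w)%g)
    (grp (w^-1 * z * g * z^-1 * w)%g) *: p (w^-1 * z)%g).
  rewrite exchange_big; apply: eq_bigr => w _.
  by rewrite ffunE sum_lfunE scaler_suml.
apply: eq_bigr => x _; rewrite ffunE scaler_sumr.
rewrite (reindex_inj (mulgI x)) /=; apply: eq_bigr => y _.
rewrite grp_twistE mulKg scalerA mulrC !invMg !invgK !mulgA.
congr (_ *: _); congr (_ * _).
by rewrite mulgK mulgV mul1g.
Qed.

Lemma kGU_act1 p : kGU_act (dd_single 1%g (hcou hH)) p = p.
Proof.
apply/ffunP=> z; rewrite ffunE (bigD1 1%g) //= ffunE eqxx bos_cou_grp scale1r.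
rewrite invg1 mul1g big1 ?addr0 // => x /negPf; rewrite ffunE => ->.
by rewrite zero_lfunE scale0r.
Qed.

Lemma kGU_act_single y f z u : kGU_act (dd_single y f) (kGU_pure z u) =
  f (grp (z * g * z^-1)%g) *: kGU_pure (y * z)%g u.
Proof.
rewrite kGU_act_pure (bigD1 y) //= ffunE eqxx big1 ?addr0 // => x /negPf.
by rewrite ffunE => ->; rewrite zero_lfunE scale0r.
Qed.

(* M(g,rho) as a module over the subalgebra generated by X, for X in the image
   of dd_grp. *)
Section WeightModule.
Variables (X : D -> Prop) (hX : forall d, X d -> exists F, d = dd_grp F).

Lemma subalg_dd_grp d : d \in subalg X -> dd_grp ((linfun dd_grp)^-1%VF d) = d.
Proof.
suff sub : (subalg X <= limg (linfun dd_grp))%VS.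
  move=> /(subvP sub) /limg_lfunVK; by rewrite lfunE.
have mem F : dd_grp F \in limg (linfun dd_grp).
  by apply/memv_imgP; exists F; rewrite ?memvf ?lfunE.
apply: agenv_sub_modl; first by rewrite -memvE -dd_grp1.
apply/prodvP => d1 d2 Xd1 /memv_imgP[F2 _ ->].
have /memv_imgP[F1 _ ->] : d1 \in limg (linfun dd_grp).
  by apply: (subvP (vspan_sub _)) Xd1 => e /hX[F ->].
by rewrite !lfunE dd_grpM.
Qed.

Definition Mgr_on of (forall d, X d -> exists F, d = dd_grp F) : Type := kGCU.
Local Notation Mgr := (Mgr_on hX).
HB.instance Definition _ := GRing.Zmodule.on Mgr.

Definition Mgr_scale (a : subvs_of (subalg X)) (m : Mgr) : Mgr :=
  quotlift (gensub_submod kGU_rel) (kGU_act ((linfun dd_grp)^-1%VF (vsval a))) m.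

Lemma Mgr_scaleE a F p : vsval a = dd_grp F ->
  Mgr_scale a (quotpi (gensub_submod kGU_rel) p) =
  quotpi (gensub_submod kGU_rel) (kGU_act F p).
Proof.
rewrite /Mgr_scale => ->; rewrite dd_grpK quotliftE //.
exact: kGU_act_stable.
Qed.

Lemma subalg_ex (a : subvs_of (subalg X)) : exists F, vsval a = dd_grp F.
Proof. by exists ((linfun dd_grp)^-1%VF (vsval a)); rewrite subalg_dd_grp ?subvsP. Qed.

Lemma Mgr_scaleA a b m : Mgr_scale a (Mgr_scale b m) = Mgr_scale (a * b) m.
Proof.
have [[F aF] [F' bF']] := (subalg_ex a, subalg_ex b).
rewrite -[m](quotreprK (cP := gensub_submod kGU_rel)) (Mgr_scaleE _ bF').
rewrite (Mgr_scaleE _ aF) (@Mgr_scaleE (a * b) (grp_mul F F')) ?kGU_actM //.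
by rewrite -dd_grpM -aF -bF'.
Qed.

Lemma Mgr_scale1 : left_id 1 Mgr_scale.
Proof.
move=> m; rewrite -[m in LHS](quotreprK (cP := gensub_submod kGU_rel)).
rewrite (@Mgr_scaleE _ (dd_single 1%g (hcou hH))).
  by rewrite kGU_act1 quotreprK.
by rewrite dd_grp1; exact: (subalg_val_is_mult X).1.
Qed.

Lemma Mgr_scaleDr : right_distributive Mgr_scale +%R.
Proof.
move=> a m m'; have [F aF] := subalg_ex a.
rewrite -[m](quotreprK (cP := gensub_submod kGU_rel)).
rewrite -[m'](quotreprK (cP := gensub_submod kGU_rel)).
rewrite -quotpiD !(Mgr_scaleE _ aF) -quotpiD; congr (quotpi _ _).
by rewrite -[X in X + _]scale1r kGU_act_linear scale1r.
Qed.

Lemma Mgr_scaleDl m : {morph Mgr_scale^~ m : a b / a + b}.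
Proof.
move=> a b; have [[F aF] [F' bF']] := (subalg_ex a, subalg_ex b).
rewrite -[m](quotreprK (cP := gensub_submod kGU_rel)).
rewrite (Mgr_scaleE _ bF') (Mgr_scaleE _ aF) -quotpiD.
rewrite (@Mgr_scaleE (a + b) (1 *: F + F')) ?kGU_actDl ?scale1r //.
by rewrite -[F]scale1r dd_grp_is_linear scale1r -aF -bF'.
Qed.

HB.instance Definition _ :=
  GRing.Zmodule_isLmodule.Build (subvs_of (subalg X)) Mgr
    Mgr_scaleA Mgr_scale1 Mgr_scaleDr Mgr_scaleDl.

Local Notation pi := (quotpi (gensub_submod kGU_rel)).

Lemma Mgr_grp a y x u : vsval a = dd_alg (grp y) ->
  a *: (pi (kGU_pure x u) : Mgr) = pi (kGU_pure (y * x)%g u).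
Proof.
rewrite dd_algE => aE; apply: etrans (Mgr_scaleE _ aE) _.
by rewrite kGU_act_single bos_cou_grp scale1r.
Qed.

Lemma Mgr_dual a f x u : vsval a = dd_dual f ->
  a *: (pi (kGU_pure x u) : Mgr) =
  pi ((f (grp (x * g * x^-1)%g) : k) *: kGU_pure x u).
Proof.
rewrite dd_dualE => aE; apply: etrans (Mgr_scaleE _ aE) _.
by rewrite kGU_act_single mul1g.
Qed.

Lemma Mgr_Vbar a y m : in_Vbar y -> vsval a = dd_dual y -> a *: (m : Mgr) = 0.
Proof.
case=> y0 _; rewrite dd_dualE -[m](quotreprK (cP := gensub_submod kGU_rel)).
have yG x : y (grp x) = 0.
  rewrite -[grp x]mul1r -(rmorph1 (bos_alg bH)); apply: (y0 0%N) => //.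
  by rewrite ndeg0 memv_line.
move=> aE; apply: etrans (Mgr_scaleE _ aE) _.
suff -> : kGU_act (dd_single 1%g y) (quotrepr m) = 0 by exact: quotpi0.
apply/ffunP=> z; rewrite !ffunE big1 // => x _; rewrite ffunE.
by case: eqP; rewrite ?zero_lfunE ?yG scale0r.
Qed.

End WeightModule.

End Weights.

Lemma Dge0_gens_dd_grp d : Dge0_gens d -> exists F, d = dd_grp F.
Proof.
case=> [[[g ->]|[f _ ->]]|[y _ ->]].
- by exists (dd_single g (hcou hH)); rewrite dd_algE.
- by exists (dd_single 1%g f); rewrite dd_dualE.
by exists (dd_single 1%g y); rewrite dd_dualE.
Qed.

Lemma DG_gens_dd_grp d : DG_gens d -> exists F, d = dd_grp F.
Proof. by move=> Gd; apply: Dge0_gens_dd_grp; left. Qed.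

Section HighestWeight.
Variables (g : gT) (n : nat) (rG : mx_representation k 'C[g]%g n).

Definition DG_weight : lmodType (subvs_of (subalg DG_gens)) :=
  Mgr_on rG DG_gens_dd_grp.

Definition Dge0_weight : lmodType (subvs_of (subalg Dge0_gens)) :=
  Mgr_on rG Dge0_gens_dd_grp.

Definition verma : lmodType D := induce (subalg_val (X := Dge0_gens)) Dge0_weight.

(* When the Verma module has a unique maximal submodule, this is the quotient by
   it: see module_rad_unique. *)
Definition verma_head : lmodType D := module_head verma.

(* M is a D(G)-submodule of N isomorphic to M(g,rho). *)
Definition has_weight (N : lmodType (subvs_of (subalg DG_gens))) (M : {pred N}) :=
  exists2 f : {linear DG_weight -> N}, injective f &
    forall x, x \in M <-> exists m, f m = x.

Definition highest_weight (N : lmodType D) :=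
  exists M : {pred restr_along (subalg_val (X := DG_gens)) N},
    [/\ simple_sub M, has_weight M,
        forall y x, in_Vbar y -> x \in M -> dd_dual y *: (x : N) = 0
      & forall P : {pred N}, submod_closed P -> {subset M <= P} ->
          forall x, x \in P].

End HighestWeight.

End DoubleModules.

(* Main.v *)
(* B^{>0} is a nilpotent ideal of B = B(V), and D = B (x) (kG (x) H^* ), where
   kG (x) H^* is D^{>= 0}: the convolution algebra of B^* is generated in degree 1
   because the primitive elements of B have degree 1. The projection of D onto
   kG (x) H^* along B^{>0} is D(G)-linear and right D^{>= 0}-linear, so that the
   Verma module maps D(G)-linearly onto M(g,rho), killing exactly B^{>0} M(g,rho).
   By Nakayama's argument, a proper D-submodule lies in the kernel; hence there is a
   unique maximal one, and M(g,rho) is recovered from the head L as L / B^{>0} L.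
   Conversely the functionals on H vanishing on kG form a nilpotent ideal of H^*, so
   they have a common zero in any simple module N, from which a copy of some M(g,rho)
   killed by \overline V is built; N is then a quotient of its Verma module. *)

Require Import Defs.
From HB Require Import structures.
From mathcomp Require Import all_boot all_order all_algebra all_fingroup all_field.
From mathcomp Require Import all_character.
From mathcomp Require Import boolp ring.
From mathcomp.multinomials Require Import freeg.

Set Implicit Arguments.
Unset Strict Implicit.
Unset Printing Implicit Defensive.

Import GRing.Theory.
Local Open Scope ring_scope.

(** * Modules, heads and induced modules *)

Section Modules.
Variable R : nzRingType.
Implicit Types N : lmodType R.

(** The algebra D^{>= 0} has two descriptions, and both are needed. As kG (x) H^* it has
    coordinates, in which its action on M(g,rho) and the projection of D are explicit formulas; as a
    subalgebra given by generators it is what a highest-weight vector is tested against. Generation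
    of the dual of B in degree 1 reconciles them. The delicate point is that the projection is
    D(G)-linear on the left. Moving a functional past b involves the iterated coproduct of b, which
    is explicit only for b of degree 1; since degree 1 generates B, that case suffices. The
    projection of the Verma module is not D-linear, so its kernel need not be a submodule. The
    maximal submodule is the largest one inside the kernel. Characteristic zero enters twice,
    through the order of the centralizer C_g: in the averaging that decides when a vector of
    M(g,rho) is zero, and in Maschke's theorem. *)

Definition mk_linear N N' (f : N -> N') (lf : linear f) : {linear N -> N'} :=
  HB.pack f (GRing.isLinear.Build R N N' *:%R f lf).

Lemma mk_linearE N N' (f : N -> N') (lf : linear f) : mk_linear lf =1 f.
Proof. by []. Qed.

Lemma submodD N (P : {pred N}) : submod_closed P ->
  {in P &, forall x y, x + y \in P}.
Proof. by move=> cP x y Px Py; rewrite -[x]scale1r cP.2. Qed.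

Lemma submodZ N (P : {pred N}) a : submod_closed P ->
  {in P, forall x, a *: x \in P}.
Proof. by move=> cP x Px; rewrite -[_ *: _]addr0 cP.2 ?cP.1. Qed.

Lemma submodB N (P : {pred N}) : submod_closed P ->
  {in P &, forall x y, x - y \in P}.
Proof. by move=> cP x y Px Py; rewrite -scaleN1r addrC cP.2. Qed.

Lemma ker_submod N N' (f : {linear N -> N'}) :
  submod_closed [pred x | f x == 0].
Proof.
split=> [|a x y]; rewrite !inE ?linear0 // => /eqP fx /eqP fy.
by rewrite linearP fx fy scaler0 addr0.
Qed.

Lemma img_submod N N' (f : {linear N -> N'}) (P : {pred N}) :
  submod_closed P -> submod_closed [pred y | `[< exists2 x, x \in P & f x = y >]].
Proof.
move=> cP; split=> [|a x y]; rewrite !inE.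
  by apply/asboolP; exists 0; rewrite ?linear0 // cP.1.
move=> /asboolP[u Pu <-] /asboolP[v Pv <-]; apply/asboolP.
by exists (a *: u + v); rewrite ?linearP // cP.2.
Qed.

Lemma inj_surj_bijective (S T : Type) (f : S -> T) :
  injective f -> (forall y, exists x, f x = y) -> bijective f.
Proof.
move=> inj surj; exists (fun y => sval (cid (surj y))) => [x|y].
  by apply: inj; case: cid.
by case: cid.
Qed.

Lemma simple_injective N N' (f : {linear N -> N'}) x0 :
  simple_module N -> f x0 != 0 -> injective f.
Proof.
case=> _ _ sN fx0; apply: raddf_inj => x fx.
have [] := sN _ (ker_submod f) (fun _ _ => isT).
  by apply; rewrite inE fx.
by move=> /(_ x0 isT); rewrite inE (negPf fx0).
Qed.

Lemma simple_surjective N N' (f : {linear N -> N'}) x0 :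
  simple_module N' -> f x0 != 0 -> forall y, exists x, f x = y.
Proof.
case=> _ _ sN fx0 y; have cT : submod_closed (predT : {pred N}) by [].
have [] := sN _ (img_submod f cT) (fun _ _ => isT).
  move/(_ (f x0)); rewrite inE => fx; case/eqP: fx0; apply: fx.
  by apply/asboolP; exists x0.
by move=> /(_ y isT); rewrite inE => /asboolP[x _ <-]; exists x.
Qed.

Lemma schur N N' (f : {linear N -> N'}) x0 :
  simple_module N -> simple_module N' -> f x0 != 0 -> bijective f.
Proof.
move=> sN sN' fx0; apply: inj_surj_bijective; first exact: simple_injective fx0.
exact: simple_surjective fx0.
Qed.

Lemma lmod_iso_sym N N' : lmod_iso N N' -> lmod_iso N' N.
Proof.
case=> f [g fK gK]; have lg : linear g.
  by move=> a x y; apply: (can_inj fK); rewrite gK linearP !gK.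
by exists (mk_linear lg); exists f.
Qed.

Lemma lmod_iso_trans N N' N'' : lmod_iso N N' -> lmod_iso N' N'' -> lmod_iso N N''.
Proof. by case=> f bf [g bg]; exists (g \o f); apply: bij_comp. Qed.

Lemma simple_sub_image N N' (f : {linear N -> N'}) (M : {pred N'}) :
  simple_module N -> injective f -> (forall x, x \in M <-> exists m, f m = x) ->
  simple_sub M.
Proof.
move=> [_ [m0 _ m0N0] sN] inj MP; split.
- split=> [|a x y /MP[m <-] /MP[m' <-]]; apply/MP.
    by exists 0; rewrite linear0.
  by exists (a *: m + m'); rewrite linearP.
- exists (f m0); first by apply/MP; exists m0.
  by rewrite raddf_eq0.
move=> P cP PM; have cQ : submod_closed [pred m | f m \in P].
  split=> [|a x y]; rewrite !inE; first by rewrite linear0 cP.1.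
  by rewrite linearP; apply: cP.2.
have [Q0|QT] := sN _ cQ (fun _ _ => isT); [left|right].
  move=> x Px; have /MP[m fm] := PM x Px; rewrite -fm.
  by rewrite (Q0 m) ?linear0 // inE fm.
by move=> x /MP[m <-]; have := QT m isT; rewrite inE.
Qed.

Lemma maximal_ker N N' (f : {linear N -> N'}) x0 :
  simple_module N' -> f x0 != 0 -> maximal_sub [pred x | f x == 0].
Proof.
move=> sN' fx0; split; first exact: ker_submod.
  by exists x0; rewrite inE.
move=> P cP kP; have [|] := boolP `[< exists2 x, x \in P & f x != 0 >].
  move=> /asboolP[x Px fxN0]; right=> y.
  have cI := img_submod f cP.
  case: sN' => _ _ /(_ _ cI (fun _ _ => isT)) [] I0.
    case/eqP: fxN0; apply: I0; rewrite inE; apply/asboolP.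
    by exists x.
  have /asboolP[z Pz fz] := I0 (f y) isT.
  rewrite -[y](subrK z) submodD // kP // inE.
  by rewrite linearB fz subrr.
move=> /asboolPn nP; left=> x Px; rewrite inE; apply/eqP.
by apply: contrapT => /eqP fx; apply: nP; exists x.
Qed.

Lemma simple_quot N (P : {pred N}) (cP : submod_closed P) :
  maximal_sub P -> simple_module (quotmod cP).
Proof.
case=> _ [x0 Px0] maxP; split=> //.
  exists (quotpi cP x0) => //; rewrite -(quotpi0 cP); apply/eqP => /quotpiP.
  by rewrite subr0; apply/negP.
move=> Q cQ _; have cQ' : submod_closed [pred x | quotpi cP x \in Q].
  split=> [|a x y]; rewrite !inE ?quotpi0 ?cQ.1 // => Qx Qy.
  by rewrite quotpiD -quot_scaleE; apply: cQ.2.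
have [|Q0|QT] := maxP _ cQ'.
- move=> x Px; rewrite inE (_ : quotpi cP x = 0) ?cQ.1 //.
  by rewrite -(quotpi0 cP); apply/quotpiP; rewrite subr0.
- left=> x Qx; rewrite -[x](quotreprK (cP := cP)) -(quotpi0 cP).
  by apply/quotpiP; rewrite subr0; apply: Q0; rewrite inE quotreprK.
right=> x _; have := QT (quotrepr x); by rewrite inE quotreprK.
Qed.

Definition quot_lift_fun N N' (P : {pred N}) (cP : submod_closed P)
  (f : {linear N -> N'}) (x : quotmod cP) : N' := f (quotrepr x).

Lemma quot_lift_funE N N' (P : {pred N}) (cP : submod_closed P)
    (f : {linear N -> N'}) :
  {in P, forall x, f x = 0} -> forall x, quot_lift_fun f (quotpi cP x) = f x.
Proof.
move=> fP x; rewrite /quot_lift_fun; apply/eqP; rewrite -subr_eq0 -linearB.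
by rewrite fP //; apply/quotpiP; rewrite quotreprK.
Qed.

Lemma quot_lift_linear N N' (P : {pred N}) (cP : submod_closed P)
    (f : {linear N -> N'}) :
  {in P, forall x, f x = 0} -> linear (quot_lift_fun f : quotmod cP -> N').
Proof.
move=> fP a x y; rewrite -[x](quotreprK (cP := cP)) -[y](quotreprK (cP := cP)).
by rewrite [_ *: _]quot_scaleE -quotpiD !quot_lift_funE // linearP.
Qed.

Lemma quotpi_linear N (P : {pred N}) (cP : submod_closed P) :
  linear (quotpi cP).
Proof. by move=> a x y; rewrite quotpiD -quot_scaleE. Qed.

(* A surjection onto a simple module has maximal kernel, so it identifies the
   head with its target as soon as the maximal submodule is unique. *)
Lemma head_iso N N' (f : {linear N -> N'}) (X : {pred N}) x0 :
  simple_module N' -> f x0 != 0 ->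
  (forall M' : {pred N}, maximal_sub M' -> M' =i X) ->
  lmod_iso N' (module_head N).
Proof.
move=> sN' fx0 uX; have mK := maximal_ker sN' fx0.
have radE : @module_rad R N =i [pred x | f x == 0].
  by apply: module_rad_unique => // M' mM' x; rewrite (uX _ mM') -(uX _ mK).
apply: lmod_iso_sym.
have f0 : {in @module_rad R N, forall x, f x = 0}.
  by move=> x; rewrite radE inE => /eqP.
exists (mk_linear (quot_lift_linear (cP := @module_rad_submod R N) f0)).
apply: inj_surj_bijective => [|y].
  apply: raddf_inj => x.
  rewrite -[x]quotreprK -(quotpi0 (@module_rad_submod R N)) => fx.
  apply/quotpiP; rewrite subr0 radE inE.
  by rewrite -(quot_lift_funE (@module_rad_submod R N) f0); apply/eqP.
have [x <-] := simple_surjective sN' fx0 y.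
by exists (quotpi (@module_rad_submod R N) x); rewrite mk_linearE quot_lift_funE.
Qed.

End Modules.

Section Induced.
Variables (A B : nzRingType) (phi : {rmorphism A -> B}) (M : lmodType A).

Definition ind_tens (b : B) (m : M) : induce phi M :=
  quotpi (gensub_submod (@indrel A B phi M)) (indpure b m).

Lemma ind_tensZ b c m : b *: ind_tens c m = ind_tens (b * c) m.
Proof.
rewrite [_ *: _]quot_scaleE; congr (quotpi _ _); rewrite /indpure.
apply/eqP/freeg_eqP => x.
by rewrite coeffZ !coeffU mulrA.
Qed.

Lemma ind_tensDl b c m : ind_tens (b + c) m = ind_tens b m + ind_tens c m.
Proof. by rewrite -quotpiD /indpure freegUD. Qed.

Lemma ind_tensDr b m m' : ind_tens b (m + m') = ind_tens b m + ind_tens b m'.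
Proof.
rewrite -quotpiD; apply/quotpiP; rewrite opprD addrA; apply: mem_gensub.
by left; exists b, m, m'.
Qed.

Lemma ind_tensA b a m : ind_tens (b * phi a) m = ind_tens b (a *: m).
Proof. by apply/quotpiP; apply: mem_gensub; right; exists b, a, m. Qed.

Lemma induce_ind (Q : induce phi M -> Prop) :
  Q 0 -> (forall x y, Q x -> Q y -> Q (x + y)) ->
  (forall b m, Q (ind_tens b m)) -> forall x, Q x.
Proof.
move=> Q0 QD Qp x; rewrite -[x]quotreprK; move: (quotrepr x) => {x} z.
rewrite -[z]freeg_sumE; elim: (dom z) => [|y s IH]; first by rewrite big_nil quotpi0.
by rewrite big_cons quotpiD; apply: QD => //; apply: Qp.
Qed.

Lemma ind_lift_ex (N : lmodType B) (f : M -> N) :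
  (forall m m', f (m + m') = f m + f m') ->
  (forall a m, f (a *: m) = phi a *: f m) ->
  exists F : {linear induce phi M -> N}, forall b m, F (ind_tens b m) = b *: f m.
Proof.
move=> fD fZ.
have lF : linear (fglift f : indfree B M -> N).
  move=> c x y; rewrite -[x]freeg_sumE -[y]freeg_sumE.
  have aD (u v : indfree B M) : fglift f (u + v) = fglift f u + fglift f v.
    have /= aB := lift_is_additive f.
    have a0 : fglift f 0 = 0 :> N by have := aB 0 0; rewrite !subrr.
    have aN w : fglift f (- w) = - fglift f w.
      by have := aB 0 w; rewrite a0 !sub0r.
    by rewrite -[v in LHS]opprK aB aN opprK.
  have a0 : fglift f (0 : indfree B M) = 0 :> N.
    by apply: (addrI (fglift f 0)); rewrite -aD !addr0.
  rewrite aD; congr (_ + _).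
  elim: (dom x) => [|z s IH]; first by rewrite !big_nil scaler0 a0 scaler0.
  rewrite !big_cons scalerDr !aD scalerDr IH; congr (_ + _).
  rewrite (_ : _ *: _ = << c * coeff z x *g z >>).
    by rewrite !liftU scalerA.
  by apply/eqP/freeg_eqP => u; rewrite coeffZ !coeffU mulrA.
have F0 : {in gensub (@indrel A B phi M), forall x, mk_linear lF x = 0}.
  suff sub : {subset gensub (@indrel A B phi M) <= [pred x | mk_linear lF x == 0]}.
    by move=> x /sub; rewrite inE => /eqP.
  apply: gensubP => [|z]; first exact: ker_submod.
  case=> [[b [m [m' ->]]]|[b [a [m ->]]]]; rewrite inE !linearB /= !liftU.
    by rewrite fD scalerDr addrAC addrK subrr.
  by rewrite fZ scalerA subrr.
exists (mk_linear (quot_lift_linear (cP := gensub_submod (@indrel A B phi M)) F0)).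
by move=> b m; rewrite mk_linearE quot_lift_funE // mk_linearE liftU.
Qed.

(** The target is a bare abelian group because the projection of the Verma module onto M(g,rho) is
    not linear over D, so that [ind_lift_ex] does not apply to it. *)
Lemma ind_pairing_ex (M' : zmodType) (beta : B -> M -> M') :
  (forall b c m, beta (b + c) m = beta b m + beta c m) ->
  (forall b m m', beta b (m + m') = beta b m + beta b m') ->
  (forall b a m, beta (b * phi a) m = beta b (a *: m)) ->
  exists F : {additive induce phi M -> M'}, forall b m, F (ind_tens b m) = beta b m.
Proof.
move=> bDl bDr bA.
have b0 m : beta 0 m = 0 by apply: (addrI (beta 0 m)); rewrite -bDl !addr0.
have bB b c m : beta (b - c) m = beta b m - beta c m.
  by apply: (addIr (beta c m)); rewrite -bDl !subrK.
pose F0 (z : indfree B M) := \sum_(m <- dom z) beta (coeff m z) m.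
(* Any duplicate-free list containing the support computes [F0], so two elements can be compared
   over a common list. *)
have F0E (s : seq M) z : uniq s -> {subset dom z <= s} ->
    F0 z = \sum_(m <- s) beta (coeff m z) m.
  move=> us sub; rewrite (bigID (mem (dom z))) /= [X in _ + X]big1 ?addr0.
    rewrite -big_filter; apply: perm_big; apply: uniq_perm.
    - exact: uniq_dom.
    - exact: filter_uniq.
    by move=> m; rewrite mem_filter; case: (boolP (m \in dom z)) => // /sub ->.
  by move=> m /coeff_outdom ->.
have F0B : zmod_morphism F0.
  move=> x y; pose s := undup (dom x ++ dom y).
  have us : uniq s by apply: undup_uniq.
  rewrite (F0E s (x - y)) ?(F0E s x) ?(F0E s y) // => [|m|m|m].
  - by rewrite -sumrB; apply: eq_bigr => m _; rewrite coeffB bB.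
  - by rewrite mem_undup mem_cat orbC => ->.
  - by rewrite mem_undup mem_cat => ->.
  by move=> /domB; rewrite mem_undup.
pose F0a : {additive indfree B M -> M'} :=
  HB.pack F0 (GRing.isZmodMorphism.Build _ _ F0 F0B).
have F0U b m : F0 (indpure b m) = beta b m.
  rewrite (F0E [:: m]) //; last first.
    move=> x; rewrite mem_dom coeffU inE; apply: contraR.
    by rewrite eq_sym => /negPf ->; rewrite mulr0.
  by rewrite big_seq1 coeffU eqxx mulr1.
have F0P : {in gensub (@indrel A B phi M), forall z, F0 z = 0}.
  (* The relations generate a [B]-submodule while [F0] is only additive; vanishing on all multiples
     of [z] is the condition that defines a submodule. *)
  suff sub : {subset gensub (@indrel A B phi M) <=
      [pred z | `[< forall c, F0 (c *: z) = 0 >]]}.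
    by move=> z /sub; rewrite inE => /asboolP/(_ 1); rewrite scale1r.
  have ZU c b m : c *: indpure b m = indpure (c * b) m.
    by apply/eqP/freeg_eqP => u; rewrite coeffZ !coeffU mulrA.
  apply: gensubP => [|z].
    split=> [|a x y]; rewrite !inE.
      by apply/asboolP => c; rewrite scaler0; apply: (raddf0 F0a).
    move=> /asboolP Fx /asboolP Fy; apply/asboolP => c.
    have F0D : {morph F0 : u v / u + v} := raddfD F0a.
    by rewrite scalerDr scalerA F0D Fx Fy addr0.
  move=> rz; rewrite inE; apply/asboolP => c.
  case: rz => [[b [m [m' ->]]]|[b [a [m ->]]]]; rewrite !scalerBr !F0B !ZU !F0U.
    by rewrite bDr addrAC addrK subrr.
  by rewrite mulrA bA subrr.
pose F (x : induce phi M) := F0 (quotrepr x).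
have FE z : F (quotpi (gensub_submod (@indrel A B phi M)) z) = F0 z.
  apply/eqP; rewrite -subr_eq0 -F0B F0P //.
  by apply/(quotpiP (gensub_submod (@indrel A B phi M))); rewrite quotreprK.
have FB : zmod_morphism F.
  move=> x y; rewrite -[x]quotreprK -[y]quotreprK.
  have qB u v : quotpi (gensub_submod (@indrel A B phi M)) u - quotpi _ v
    = quotpi _ (u - v).
    apply: (addIr (quotpi (gensub_submod (@indrel A B phi M)) v)).
    by rewrite -quotpiD !subrK.
  by rewrite qB !FE F0B.
pose Fa : {additive induce phi M -> M'} :=
  HB.pack F (GRing.isZmodMorphism.Build _ _ F FB).
by exists Fa => b m; rewrite /Fa /= FE F0U.
Qed.

End Induced.

(** * Linear forms on tensor products and convolution *)

Section LinearForms.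
Variable k : fieldType.

Lemma tlift_eq (U W X : vectType k) (b b' : U -> W -> X) t :
  (forall u w, b u w = b' u w) -> tlift b t = tlift b' t.
Proof.
by move=> bb'; rewrite /tlift; apply: eq_bigr => i _; apply: eq_bigr => j _; rewrite bb'.
Qed.

Lemma tlift_eqk (U W : vectType k) (b b' : U -> W -> k^o) t :
  (forall u w, b u w = b' u w) -> tlift b t = tlift b' t :> k.
Proof. exact: tlift_eq. Qed.

Lemma linear_tlift (U W X X' : vectType k) (L : {linear X -> X'})
    (b : U -> W -> X) t :
  L (tlift b t) = tlift (fun u w => L (b u w)) t.
Proof.
rewrite /tlift linear_sum; apply: eq_bigr => i _.
by rewrite linear_sum; apply: eq_bigr => j _; rewrite linearZ.
Qed.

Definition bilin (U W X : vectType k) (b : U -> W -> X) :=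
  (forall w, linear (b^~ w)) /\ (forall u, linear (b u)).

Lemma tlift_purE (U W X : vectType k) (b : U -> W -> X) u w :
  bilin b -> tlift b (tpure u w) = b u w.
Proof. by case; apply: tlift_pure. Qed.

Lemma tpure0r (U W : vectType k) (u : U) : tpure u (0 : W) = 0.
Proof. by apply/matrixP => i j; rewrite !mxE linear0 mulr0. Qed.

Lemma bilin_tpure (U W : vectType k) : bilin (@tpure k U W).
Proof. by split=> [w a u v|u a w v]; rewrite (tpureDl, tpureDr). Qed.

Lemma bilin_mul (C C' : vectType k) (f : {linear C -> k^o}) (g : {linear C' -> k^o}) :
  bilin (fun u w => f u * g w : k^o).
Proof.
split=> [w a u v|u a w v]; rewrite linearP.
  by rewrite mulrDl -scalerAl.
by rewrite mulrDr -scalerAr.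
Qed.

Lemma bilin_comp (U W X Y Z : vectType k) (b : X -> Y -> Z)
    (f : {linear U -> X}) (g : {linear W -> Y}) :
  bilin b -> bilin (fun u w => b (f u) (g w)).
Proof. by case=> bl br; split=> [w a u v|u a w v]; rewrite linearP ?bl ?br. Qed.

Lemma bilin_sum (I : finType) (U W X : vectType k) (b : I -> U -> W -> X) :
  (forall i, bilin (b i)) -> bilin (fun u w => \sum_i b i u w).
Proof.
move=> bb; split=> [w a u v|u a w v]; rewrite scaler_sumr -big_split;
  by apply: eq_bigr => i _; have [bl br] := bb i; rewrite ?bl ?br.
Qed.

Lemma tlift_entry (U W U' W' : vectType k) (b : U -> W -> tens U' W') t i j :
  tlift b t i j = tlift (fun u w => (b u w i j : k^o)) t.
Proof.
have le : linear (fun s : tens U' W' => (s i j : k^o)).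
  by move=> a s s'; rewrite !mxE.
exact: (linear_tlift (mk_linear le)).
Qed.

Lemma tlift_coord (U W : vectType k) (t : tens U W) i j :
  tlift (fun u w => coord (vbasis {:U}) i u * coord (vbasis {:W}) j w : k^o) t
  = t i j.
Proof.
have cb (X : vectType k) (a b : 'I_(\dim {:X})) :
    coord (vbasis {:X}) a (vbasis {:X})`_b = (a == b)%:R.
  by rewrite coord_free ?(basis_free (vbasisP _)) // eq_sym.
rewrite /tlift (bigD1 i) //= [X in _ + X]big1 ?addr0 => [|i' /negPf ii'].
  rewrite (bigD1 j) //= [X in _ + X]big1 ?addr0 => [|j' /negPf jj'].
    by rewrite !cb !eqxx mulr1 [LHS]mulr1.
  by rewrite !cb (eq_sym j) jj' mulr0 scaler0.
by rewrite big1 // => j' _; rewrite !cb (eq_sym i) ii' mul0r scaler0.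
Qed.

Lemma tlift_tpure (U W : vectType k) (t : tens U W) : tlift (@tpure k U W) t = t.
Proof.
apply/matrixP => i j; rewrite tlift_entry -[RHS]tlift_coord.
by apply: tlift_eqk => u w; rewrite mxE.
Qed.

Lemma tens_eq0 (U W : vectType k) (t : tens U W) :
  (forall (f : 'Hom(U, k^o)) (g : 'Hom(W, k^o)),
     tlift (fun u w => f u * g w : k^o) t = 0) -> t = 0.
Proof.
move=> t0; apply/matrixP => i j; rewrite mxE.
have lc (X : vectType k) i0 : linear (coord (vbasis {:X}) i0 : X -> k^o).
  by move=> a x y; rewrite linearP.
pose c (X : vectType k) i0 : {linear X -> k^o} := mk_linear (lc X i0).
rewrite -[LHS]tlift_coord -[RHS](t0 (linfun (c U i)) (linfun (c W j))).
by apply: tlift_eqk => u w; rewrite !lfunE.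
Qed.

(** Evaluating a basis of [T] gives a map [beta] whose kernel lies in that of [f]; hence [f] factors
    through [beta] and is a combination of its coordinates. *)
Lemma double_annihilator (U : vectType k) (T : {vspace 'Hom(U, k^o)})
    (f : 'Hom(U, k^o)) :
  (forall u, (forall t, t \in T -> t u = 0) -> f u = 0) -> f \in T.
Proof.
move=> fT; pose d := \dim T.
pose beta (u : U) : 'rV[k]_d := \row_i ((vbasis T)`_i u : k).
have lb : linear beta by move=> a u v; apply/rowP => i; rewrite !mxE linearP.
pose bL : {linear U -> 'rV[k]_d} := mk_linear lb.
pose B := linfun bL.
have fB u : f u = f ((B^-1)%VF (B u)).
  apply/eqP; rewrite -subr_eq0 -linearB; apply/eqP/fT => t Tt.
  set v := u - _; have Bv : B v = 0.
    by rewrite linearB /= limg_lfunVK ?subrr // memv_img ?memvf.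
  rewrite (coord_vbasis Tt) sum_lfunE big1 // => i _; rewrite scale_lfunE.
  move: Bv; rewrite lfunE => /rowP/(_ i); rewrite !mxE => ->.
  by rewrite scaler0.
have -> : f = \sum_i (f ((B^-1)%VF (delta_mx 0 i)) : k) *: (vbasis T)`_i.
  apply/lfunP => u; rewrite fB sum_lfunE lfunE /= {1}[beta u]row_sum_delta.
  rewrite !linear_sum; apply: eq_bigr => i _.
  by rewrite scale_lfunE !linearZ !mxE /= /GRing.scale /= mulrC.
apply: memv_suml => i _; apply/memvZ/vbasis_mem/mem_nth.
by rewrite size_tuple.
Qed.

(** [Q] is a mere proposition, so it does not directly define a subspace. A subspace of largest
    dimension inside [Q] replaces it: adjoining any [x] in [X] stays inside [Q], so [x] already
    belongs to it. *)
Lemma vspan_ind (U : vectType k) (X Q : U -> Prop) :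
  Q 0 -> (forall a u v, Q u -> Q v -> Q (a *: u + v)) -> (forall u, X u -> Q u) ->
  forall u, u \in vspan X -> Q u.
Proof.
move=> Q0 QP XQ.
pose D n := `[< exists2 W : {vspace U}, forall x, x \in W -> Q x & \dim W = n >].
have exD : exists n, D n.
  exists 0%N; apply/asboolP; exists 0%VS; last exact: dimv0.
  by move=> x /[!memv0] /eqP ->.
have ubD n : D n -> (n <= \dim {:U})%N.
  by move=> /asboolP[W _ <-]; apply/dimvS/subvf.
case: (ex_maxnP exD ubD) => _ /asboolP[W WQ <-] maxW.
suff /subvP sub : (vspan X <= W)%VS by move=> u /sub /WQ.
apply: vspan_sub => x Xx.
have /eqP eqW : W == (W + <[x]>)%VS.
  rewrite eqEdim addvSl maxW //; apply/asboolP; exists (W + <[x]>)%VS => //.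
  move=> _ /memv_addP[w Ww [_ /vlineP[c ->] ->]].
  by rewrite addrC; apply: QP; [apply: XQ|apply: WQ].
by rewrite eqW; apply: (subvP (addvSr _ _)); apply: memv_line.
Qed.

(** For the coproduct of [H] this is [dual_mul]; the general form also covers the dual of the
    braided Hopf algebra [B]. *)
Definition conv (C : vectType k) (Dl : 'Hom(C, tens C C)) (f g : 'Hom(C, k^o)) :
  'Hom(C, k^o) := (linfun (tlift (fun a b => f a * g b : k^o)) \o Dl)%VF.

Lemma convE (C : vectType k) (Dl : 'Hom(C, tens C C)) f g c :
  conv Dl f g c = tlift (fun a b => f a * g b : k^o) (Dl c).
Proof. by rewrite comp_lfunE lfunE. Qed.

Lemma convDl (C : vectType k) (Dl : 'Hom(C, tens C C)) a f f' g :
  conv Dl (a *: f + f') g = a *: conv Dl f g + conv Dl f' g.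
Proof.
apply/lfunP => c; rewrite add_lfunE scale_lfunE !convE /tlift scaler_sumr -big_split.
apply: eq_bigr => i _ /=; rewrite scaler_sumr -big_split; apply: eq_bigr => j _ /=.
by rewrite add_lfunE scale_lfunE /GRing.scale /= mulrDl mulrDr -mulrA mulrCA.
Qed.

Lemma convDr (C : vectType k) (Dl : 'Hom(C, tens C C)) a f g g' :
  conv Dl f (a *: g + g') = a *: conv Dl f g + conv Dl f g'.
Proof.
apply/lfunP => c; rewrite add_lfunE scale_lfunE !convE /tlift scaler_sumr -big_split.
apply: eq_bigr => i _ /=; rewrite scaler_sumr -big_split; apply: eq_bigr => j _ /=.
by rewrite add_lfunE scale_lfunE /GRing.scale /= !mulrDr (mulrCA _ a) (mulrCA _ a).
Qed.

Lemma convBl (C : vectType k) (Dl : 'Hom(C, tens C C)) f f' g :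
  conv Dl (f - f') g = conv Dl f g - conv Dl f' g.
Proof. by rewrite addrC -scaleN1r convDl scaleN1r addrC. Qed.

Lemma convBr (C : vectType k) (Dl : 'Hom(C, tens C C)) f g g' :
  conv Dl f (g - g') = conv Dl f g - conv Dl f g'.
Proof. by rewrite addrC -scaleN1r convDr scaleN1r addrC. Qed.

Section Counit.
Variables (C : vectType k) (Dl : 'Hom(C, tens C C)) (e : 'Hom(C, k^o)).
Hypothesis coalg : is_coalgebra Dl e.

Lemma conv1l f : conv Dl e f = f.
Proof.
apply/lfunP => c; have [_ el _] := coalg; rewrite convE -[in RHS](el c).
rewrite linear_tlift; apply: tlift_eqk => a b; by rewrite linearZ.
Qed.

Lemma conv1r f : conv Dl f e = f.
Proof.
apply/lfunP => c; have [_ _ er] := coalg; rewrite convE -[in RHS](er c).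
rewrite linear_tlift; apply: tlift_eqk => a b.
by rewrite linearZ /= /GRing.scale /= mulrC.
Qed.

End Counit.

End LinearForms.

(** * The graded dual of a Nichols algebra *)

Section Nichols.
Variables (k : fieldType) (gT : finGroupType) (V : vectType k) (YV : ydMod gT V).
Variables (B : falgType k) (NB : nichols YV B).
Local Notation Bd := 'Hom(B, k^o).
Local Notation deg := (ndeg NB).

(** Finitely many degrees already fill [B], and directness leaves nothing for the others. All
    nilpotency arguments rest on this. *)
Lemma ndeg_high : exists N, forall m b, (N <= m)%N -> b \in deg m -> b = 0.
Proof.
have [N defB] := ndeg_full NB; exists N => m b leNm bm.
have /directv_sumP/(_ ord_max isT) := ndeg_direct NB m.+1.
move=> /(congr1 (fun U : {vspace B} => b \in U)).
rewrite memv_cap bm memv0 /= => b0; apply/eqP; rewrite -b0.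
apply: (subvP _ _ (memvf b)).
rewrite -defB; apply/subv_sumP => i _.
have im : (i < m.+1)%N by rewrite ltnS (leq_trans _ leNm) // ltnW.
rewrite (sumv_sup (Ordinal im)) //.
by rewrite -val_eqE /= neq_ltn (leq_trans (ltn_ord i)).
Qed.

Lemma ndeg_sum b : exists (N : nat) (bs : nat -> B),
  (forall i, bs i \in deg i) /\ b = \sum_(i < N) bs i.
Proof.
have [N defB] := ndeg_full NB; exists N.
have /memv_sumP[bs bsP ->] : b \in (\sum_(i < N) deg i)%VS by rewrite defB memvf.
exists (fun i => if insub i is Some j then bs j else 0).
split=> [i|]; last by apply: eq_bigr => i _; rewrite valK.
by case: insubP => [j _ <-|_]; rewrite ?mem0v ?bsP.
Qed.

Lemma ndeg_ind (P : B -> Prop) : P 0 -> (forall a b, P a -> P b -> P (a + b)) ->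
  (forall m b, b \in deg m -> P b) -> forall b, P b.
Proof.
move=> P0 PD Pm b; have [N [bs [bsP ->]]] := ndeg_sum b.
by apply: (big_ind P) => // i _; apply: Pm (bsP i).
Qed.

Lemma ndeg_proj m : exists p : 'End(B), (forall b, b \in deg m -> p b = b) /\
  (forall i b, b \in deg i -> i != m -> p b = 0).
Proof.
have [N hi] := ndeg_high; have [N' defB] := ndeg_full NB.
(* The degrees below [M] fill [B] by [N'], include [m], and by [N] every degree outside this range
   is zero. *)
pose M := (maxn (maxn N N') m).+1.
have mM : (m < M)%N by rewrite ltnS leq_maxr.
have defM : {:B}%VS = (\sum_(i < M) deg i)%VS.
  apply/eqP; rewrite eqEsubv subvf andbT -{1}defB; apply/subv_sumP => i _.
  have iM : (i < M)%N.
    by rewrite ltnS (leq_trans (ltnW (ltn_ord i))) // !leq_max leqnn !orbT.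
  by rewrite (sumv_sup (Ordinal iM)).
pose p := sumv_pi_for defM (Ordinal mM); exists p.
have pE (j : 'I_M) b : b \in deg j -> p b = if Ordinal mM == j then b else 0.
  move=> bj.
  have /directv_sum_independent indep := ndeg_direct NB M.
  apply/eqP; rewrite -subr_eq0; apply/eqP.
  apply: (indep (fun i => sumv_pi_for defM i b - if i == j then b else 0)) => //.
    by move=> i _; rewrite memvB ?memv_sum_pi //; case: eqP => [->|_]; rewrite ?mem0v.
  by rewrite sumrB sumv_pi_sum ?memvf // -big_mkcond big_pred1_eq subrr.
split=> [b bm|i b bi im]; first by rewrite (pE (Ordinal mM)) ?eqxx.
have [iM|leMi] := ltnP i M; last first.
  rewrite (hi _ _ _ bi) ?linear0 //; apply: leq_trans leMi.
  by rewrite (leq_trans (leq_maxl N N')) // (leq_trans (leq_maxl _ m)).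
by rewrite (pE (Ordinal iM)) // -val_eqE /= eq_sym (negPf im).
Qed.

Lemma ncop_ndeg0 (X : vectType k) (beta : B -> B -> X) m b :
  bilin beta ->
  (forall i u w, (i <= m)%N -> u \in deg i -> w \in deg (m - i)%N -> beta u w = 0) ->
  b \in deg m -> tlift beta (ncop NB b) = 0.
Proof.
move=> bb b0 bm.
suff /subvP/(_ _ (ndeg_cop bm)) : (\sum_(i < m.+1) tensv (deg i) (deg (m - i)%N)
    <= lker (linfun (tlift beta)))%VS.
  by rewrite memv_ker lfunE => /eqP.
apply/subv_sumP => i _; apply: vspan_sub => _ [u [w [ui wi ->]]].
by rewrite memv_ker lfunE /= tlift_purE // (b0 i) // -ltnS.
Qed.

(** The filtration of the dual of [B] by annihilators of the low degrees: multiplicative for [conv],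
    and zero from some index on. *)
Definition low_zero n (f : Bd) := forall m b, (m < n)%N -> b \in deg m -> f b = 0.

Lemma low_zero_conv n m f g : low_zero n f -> low_zero m g ->
  low_zero (n + m) (conv (ncop NB) f g).
Proof.
move=> fn gm d b dnm bd; rewrite convE (ncop_ndeg0 _ _ bd) //.
  exact: bilin_mul.
move=> i u w id ui wi; have [lin|leni] := ltnP i n.
  by rewrite (fn i) // mul0r.
rewrite (gm (d - i)%N) ?mulr0 // ltn_subLR //.
by rewrite (leq_trans dnm) // leq_add2r.
Qed.

Lemma low_zero_all : exists N, forall n f, (N <= n)%N -> low_zero n f -> f = 0.
Proof.
have [N hi] := ndeg_high; exists N => n f leNn fn; apply/lfunP => b.
rewrite zero_lfunE; move: b; apply: ndeg_ind => [|a b fa fb|m b bm].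
- exact: linear0.
- by rewrite linearD /= fa fb addr0.
have [/fn|lenm] := ltnP m n; first exact.
by rewrite (hi m b) ?linear0 // (leq_trans leNn).
Qed.

Lemma low_zero1 (f : Bd) : f 1 = 0 -> low_zero 1 f.
Proof.
move=> f1 m b; rewrite ltnS leqn0 => /eqP ->; rewrite ndeg0 => /vlineP[c ->].
by rewrite linearZ /= f1 scaler0.
Qed.

(* The elements killed by the augmentation and by every product of two
   functionals vanishing at 1 are primitive, hence of degree 1; dually, modulo
   such products every functional vanishing at 1 is concentrated in degree 1. *)
Lemma low_zero1_mod_sq (f : Bd) : f 1 = 0 ->
  exists2 f1 : Bd, (forall m b, b \in deg m -> m != 1%N -> f1 b = 0) &
    f - f1 \in vspan (fun t => exists g h : Bd,
      [/\ g 1 = 0, h 1 = 0 & t = conv (ncop NB) g h]).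
Proof.
move=> f0; have [p [p1 pn1]] := ndeg_proj 1.
exists (f \o p)%VF => [m b bm m1|].
  by rewrite comp_lfunE (pn1 m) ?linear0.
apply: double_annihilator => b bT.
have gh0 (g h : Bd) : g 1 = 0 -> h 1 = 0 -> conv (ncop NB) g h b = 0.
  by move=> g1 h1; apply: bT; apply: mem_vspan; exists g, h.
(* It remains to see that [b] minus its counit part is primitive, hence of degree 1, where [f] and
   [f \o p] agree. *)
pose e := ncou NB; have [a aE] : exists a, a = b - (e b : k) *: 1 by eexists.
suff a1 : a \in deg 1%N.
  have -> : b = a + (e b : k) *: 1 by rewrite aE subrK.
  rewrite linearD linearZ /= !add_lfunE !opp_lfunE !comp_lfunE p1 // subrr add0r.
  have p10 : p 1 = 0 by rewrite (pn1 0%N 1) // ndeg0 memv_line.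
  by rewrite p10 linear0 f0 subr0 scaler0.
apply/ndeg1_prim/eqP; rewrite -subr_eq0; apply/eqP; apply: tens_eq0 => g h.
rewrite linearB linearD /= !tlift_purE; do ?exact: bilin_mul.
have coalg := nichols_coalg NB.
rewrite -convE aE linearB linearZ /= (convE _ _ _ 1) ncop1 tlift_purE; last exact: bilin_mul.
(* Correcting [g] and [h] by multiples of the counit makes them vanish at 1; expanding their product
   at [b] gives exactly the primitivity of [a] tested on [g] and [h]. *)
have n0 (u : Bd) : ((- u 1 : k) *: e + u) 1 = 0.
  by rewrite add_lfunE scale_lfunE /e ncou1 /GRing.scale /= mulr1 addNr.
have := gh0 _ _ (n0 g) (n0 h); rewrite convDl !convDr !(conv1l coalg) (conv1r coalg).
rewrite !add_lfunE !scale_lfunE !add_lfunE !scale_lfunE /e /GRing.scale /=.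
rewrite !linearD !linearN !linearZ /= /GRing.scale /= => E0.
rewrite -[RHS]E0; ring.
Qed.

(** Successive approximation: a functional vanishing at 1 agrees with an element of [T] in all
    degrees below [n], for every [n], and for large [n] the error is zero. *)
Lemma conv_generated (T : {vspace Bd}) :
  ncou NB \in T ->
  (forall f : Bd, (forall m b, b \in deg m -> m != 1%N -> f b = 0) -> f \in T) ->
  (forall f g, f \in T -> g \in T -> conv (ncop NB) f g \in T) ->
  forall f, f \in T.
Proof.
move=> Te T1 TM.
have step n (f : Bd) : (0 < n)%N -> f 1 = 0 ->
    exists2 t, t \in T & low_zero n (f - t).
  case: n => // n _; elim: n f => [|n IH] f f0.
    by exists 0; rewrite ?mem0v // subr0; apply: low_zero1.
  have [f1 /T1 Tf1 sf] := low_zero1_mod_sq f0.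
  suff [t Tt ft] : exists2 t, t \in T & low_zero n.+2 (f - f1 - t).
    by exists (f1 + t); rewrite ?memvD // opprD addrA.
  move: sf; set F := f - f1; clearbody F.
  move: F; apply: vspan_ind => [|a u v [t Tt ut] [s Ts vs]|].
  - by exists 0; rewrite ?mem0v // subr0 => m b _ _; rewrite zero_lfunE.
  - exists (a *: t + s); first by rewrite memvD ?memvZ.
    rewrite opprD addrACA -scalerBr => m b mn bm.
    by rewrite add_lfunE scale_lfunE (ut m) ?(vs m) // scaler0 addr0.
  move=> _ [g [h [g0 h0 ->]]].
  have [[t Tt gt] [s Ts hs]] := (IH g g0, IH h h0).
  exists (conv (ncop NB) t s); first exact: TM.
  (* If [t] and [s] approximate [g] and [h] up to order [n.+1], their product gains one order,
     because [h] and [t] vanish at 1. *)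
  have -> : conv (ncop NB) g h - conv (ncop NB) t s =
      conv (ncop NB) (g - t) h + conv (ncop NB) t (h - s).
    by rewrite convBl convBr addrA subrK.
  have lt : low_zero 1 t.
    by apply: low_zero1; have := gt 0%N 1 isT; rewrite ndeg0 memv_line => /(_ isT)
      /eqP; rewrite add_lfunE opp_lfunE g0 sub0r oppr_eq0 => /eqP.
  move=> m b mn bm; rewrite add_lfunE.
  have lh : low_zero 1 h by apply: low_zero1.
  rewrite (low_zero_conv gt lh _ bm) ?addn1 //.
  by rewrite (low_zero_conv lt hs _ bm) ?addr0 // add1n.
have [N hiN] := low_zero_all => f.
have f0 : (f - (f 1 : k) *: ncou NB) 1 = 0.
  by rewrite add_lfunE opp_lfunE scale_lfunE ncou1 /GRing.scale /= mulr1 subrr.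
have [t Tt /(hiN N.+1 _ (leqnSn N)) ft] := step N.+1 _ isT f0.
rewrite -[f](subrK ((f 1 : k) *: ncou NB)) memvD ?memvZ //.
by move/eqP: ft; rewrite subr_eq0 => /eqP ->.
Qed.

End Nichols.

(** * Functionals on the bosonization *)

Section Bosonization.
Variables (k : fieldType) (gT : finGroupType) (V : vectType k) (YV : ydMod gT V).
Variables (B : falgType k) (NB : nichols YV B).
Variables (H : falgType k) (hH : hopf H) (bH : bosonization NB hH).
Local Notation Bd := 'Hom(B, k^o).
Local Notation Hd := 'Hom(H, k^o).
Local Notation deg := (ndeg NB).
Local Notation grp := (bos_grp bH).
Local Notation alg := (bos_alg bH).
Local Notation "b # g" := (alg b * grp g) (at level 40).

Lemma bos_ind (P : H -> Prop) : (forall x y, P x -> P y -> P (x + y)) ->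
  (forall b g, P (b # g)) -> forall h, P h.
Proof.
move=> PD Pp h; have [inv _ invK] := bos_bij bH; rewrite -[h]invK.
apply: (big_ind P) => //.
by have := Pp 0 1%g; rewrite linear0 mul0r.
Qed.

Lemma bos_fun_ext (X : vectType k) (f f' : 'Hom(H, X)) :
  (forall b g, f (b # g) = f' (b # g)) -> f = f'.
Proof.
move=> ff'; apply/lfunP; apply: bos_ind => // x y fx fy.
by rewrite !linearD /= fx fy.
Qed.

Lemma bos_coord_ex : exists c : gT -> 'Hom(H, B),
  forall x b g, c x (b # g) = if g == x then b else 0.
Proof.
pose io (u : {ffun gT -> B}) := \sum_g u g # g.
have lio : linear io.
  move=> a u v; rewrite /io scaler_sumr -big_split; apply: eq_bigr => g _ /=.
  by rewrite !ffunE linearP mulrDl -scalerAl.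
pose ioL : {linear {ffun gT -> B} -> H} := mk_linear lio.
have ioK : cancel io (linfun ioL)^-1%VF.
  move=> u; rewrite -[io u](lfunE ioL) lker0_lfunK //.
  by apply/lker0P => v w; rewrite !lfunE /= => /(bij_inj (bos_bij bH)).
have le x : linear (fun u : {ffun gT -> B} => u x) by move=> a u v; rewrite !ffunE.
pose e x : {linear {ffun gT -> B} -> B} := mk_linear (le x).
exists (fun x => linfun (e x) \o (linfun ioL)^-1)%VF => x b g.
have -> : b # g = io [ffun y => if y == g then b else 0].
  rewrite /io (bigD1 g) //= ffunE eqxx big1 ?addr0 // => y /negPf yg.
  by rewrite ffunE yg linear0 mul0r.
by rewrite comp_lfunE ioK lfunE /= ffunE eq_sym.
Qed.

(** Identifies the dual of [H] with families of functionals on [B] indexed by [G], [phi g] being the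
    restriction to [B # g]. *)
Definition bos_fun (phi : gT -> Bd) : Hd :=
  \sum_x (phi x \o sval (cid bos_coord_ex) x)%VF.

Lemma bos_funE phi b g : bos_fun phi (b # g) = phi g b.
Proof.
rewrite /bos_fun; case: cid => c cE /=; rewrite sum_lfunE (bigD1 g) //= comp_lfunE.
rewrite cE eqxx big1 ?addr0 // => x /negPf xg.
by rewrite comp_lfunE cE eq_sym xg linear0.
Qed.

Lemma bos_fun_rep (f : Hd) : exists phi : gT -> Bd, f = bos_fun phi.
Proof.
exists (fun g => f \o amulr (grp g) \o linfun alg)%VF; apply: bos_fun_ext => b g.
by rewrite bos_funE !comp_lfunE !lfunE.
Qed.

Lemma bos_algE b : alg b = b # 1%g. Proof. by rewrite bos_grp1 mulr1. Qed.

Lemma hcop_bos b g : hcop hH (b # g) = tlift (fun b1 b2 =>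
  \sum_(t : gT) tpure (b1 # (t * g)%g) (ycoact (nyd NB) t b2 # g)) (ncop NB b).
Proof.
have br (x : H) : linear (fun u : H => u * x).
  by move=> a u v; rewrite mulrDl -scalerAl.
pose mr x : {linear H -> H} := mk_linear (br x).
have bl (x : H) : linear (fun u : H => x * u).
  by move=> a u v; rewrite mulrDr -scalerAr.
pose ml x : {linear H -> H} := mk_linear (bl x).
have b2 (a1 a2 : H) : bilin (fun b1 b2 => tpure (a1 * b1) (a2 * b2) : tens H H).
  exact: (@bilin_comp k H H H H _ _ (ml a1) (ml a2) (@bilin_tpure k H H)).
rewrite hcopM bos_cop_grp.
transitivity (tlift (fun a1 a2 => tpure (a1 * grp g) (a2 * grp g) : tens H H)
    (hcop hH (alg b))).
  by apply: tlift_eq => a1 a2; rewrite tlift_purE.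
have bg : bilin (fun a1 a2 => tpure (a1 * grp g) (a2 * grp g) : tens H H).
  exact: (@bilin_comp k H H H H _ _ (mr (grp g)) (mr (grp g)) (@bilin_tpure k H H)).
rewrite bos_cop_alg [LHS]linear_tlift; apply: tlift_eq => b1 b2'.
rewrite linear_sum; apply: eq_bigr => t _ /=.
by rewrite tlift_purE // bos_grpM mulrA.
Qed.

Lemma dual_mul_bos (f f' : Hd) b g : dual_mul hH f f' (b # g) =
  tlift (fun b1 b2 => \sum_(t : gT)
    f (b1 # (t * g)%g) * f' (ycoact (nyd NB) t b2 # g) : k^o) (ncop NB b).
Proof.
rewrite dual_mulE hcop_bos [LHS]linear_tlift; apply: tlift_eq => b1 b2.
rewrite linear_sum; apply: eq_bigr => t _ /=.
by rewrite tlift_purE //; apply: bilin_mul.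
Qed.

(** As the left factor ignores the group component, the coaction components of the second leg of the
    coproduct add up to that leg. So the dual of [B] embeds with its convolution product. *)
Lemma dual_mul_bos_fun phi psi :
  dual_mul hH (bos_fun (fun=> phi)) (bos_fun psi) =
  bos_fun (fun g => conv (ncop NB) phi (psi g)).
Proof.
apply: bos_fun_ext => b g; rewrite dual_mul_bos bos_funE convE.
apply: tlift_eq => b1 b2.
under eq_bigr => t _ do rewrite !bos_funE.
by rewrite -mulr_sumr -linear_sum /= ycoact_sum.
Qed.

Definition dual_grp (chi : gT -> k) : Hd := bos_fun (fun g => chi g *: ncou NB).

Lemma dual_grpE chi g : dual_grp chi (grp g) = chi g.
Proof.
rewrite -[grp g]mul1r -(rmorph1 alg) bos_funE scale_lfunE ncou1.
exact: mulr1.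
Qed.

Lemma dual_grp_in chi : in_dualG bH (dual_grp chi).
Proof.
move=> m b g bm m0; rewrite bos_funE scale_lfunE (ndeg_cou bm) ?scaler0 //.
by rewrite lt0n.
Qed.

Lemma dual_mul_grpl chi f x :
  dual_mul hH (dual_grp chi) f (grp x) = (chi x * f (grp x) : k).
Proof.
rewrite dual_mulE bos_cop_grp tlift_purE ?dual_grpE //.
exact: bilin_mul.
Qed.

(** The dual of [H] is spanned by products of a functional from [B] and an indicator function on
    [G]; membership in D^{>= 0} can be checked on the two factors. *)
Lemma bos_fun_dual_mul phi :
  bos_fun phi = \sum_x dual_mul hH (bos_fun (fun=> phi x))
    (dual_grp (fun g => (g == x)%:R)).
Proof.
apply: bos_fun_ext => b g; rewrite bos_funE [RHS]sum_lfunE (bigD1 g) //= big1.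
  by rewrite addr0 dual_mul_bos_fun bos_funE eqxx scale1r (conv1r (nichols_coalg NB)).
move=> x /negPf xg; rewrite dual_mul_bos_fun bos_funE eq_sym xg scale0r.
by rewrite -[X in conv _ _ X](subrr 0) convBr subrr zero_lfunE.
Qed.

Definition bos_low_zero n (f : Hd) :=
  forall m b g, (m < n)%N -> b \in deg m -> f (b # g) = 0.

Lemma bos_low_zero_mul n (f f' : Hd) : bos_low_zero n f -> (forall g, f' (grp g) = 0) ->
  bos_low_zero n.+1 (dual_mul hH f f').
Proof.
move=> fn f0 m b g mn bm; rewrite dual_mul_bos (ncop_ndeg0 _ _ bm) //.
  apply: bilin_sum => t.
  pose f1 : 'Hom(B, k^o) := (f \o amulr (grp (t * g)%g) \o linfun alg)%VF.
  pose f2 : 'Hom(B, k^o) := (f' \o amulr (grp g) \o linfun alg \o ycoact (nyd NB) t)%VF.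
  have f1E u : f (u # (t * g)%g) = f1 u by rewrite /f1 !comp_lfunE !lfunE.
  have f2E u : f' (ycoact (nyd NB) t u # g) = f2 u by rewrite /f2 !comp_lfunE !lfunE.
  have [bl br] := bilin_mul f1 f2.
  by split=> [w a u v|u a w v]; rewrite !f1E !f2E ?(bl w) ?(br u).
move=> i u w im ui wi; rewrite big1 // => t _.
have [lin|leni] := ltnP i n; first by rewrite (fn i) // mul0r.
(* From [n <= i <= m <= n] the second leg has degree 0; the coaction keeps it there, so it lands in
   kG, which [f'] kills. *)
have mi0 : (m - i = 0)%N by apply/eqP; rewrite subn_eq0 (leq_trans _ leni).
move: wi; rewrite mi0 => /(ndeg_coact t); rewrite ndeg0 => /vlineP[c ->].
by rewrite linearZ /= rmorph1 -scalerAl mul1r linearZ /= f0 scaler0 mulr0.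
Qed.

Lemma bos_low_zero_all : exists N, forall f, bos_low_zero N f -> f = 0.
Proof.
have [N hiN] := low_zero_all NB; exists N => f fN.
have [phi fE] := bos_fun_rep f; rewrite fE; apply: bos_fun_ext => b g.
rewrite bos_funE; suff -> : phi g = 0 by rewrite !zero_lfunE.
apply: (hiN N) => // m c mN cm.
by rewrite -bos_funE -fE (fN m).
Qed.

End Bosonization.

(** * The triangular structure of the double *)

(** The span of [Q] is a subspace that lies inside [Q] by [vspan_ind] and is stable under left
    multiplication by [U], so it contains the generated algebra. *)
Lemma agenv_ind (k : fieldType) (A : falgType k) (U : {vspace A}) (Q : A -> Prop) :
  (forall a x y, Q x -> Q y -> Q (a *: x + y)) -> Q 0 -> Q 1 ->
  (forall u x, u \in U -> Q x -> Q (u * x)) -> forall x, x \in agenv U -> Q x.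
Proof.
move=> QP Q0 Q1 QM x Ux; apply: (vspan_ind (X := Q)) => //.
apply: (subvP _ _ Ux); apply: agenv_sub_modl; first by rewrite -memvE mem_vspan.
apply/prodvP => u w Uu Qw; apply: mem_vspan; apply: QM => //.
exact: (vspan_ind (X := Q)) Qw.
Qed.

Lemma subalg_ind (k : fieldType) (A : falgType k) (X : A -> Prop) (Q : A -> Prop) :
  (forall a x y, Q x -> Q y -> Q (a *: x + y)) -> Q 0 -> Q 1 ->
  (forall u x, X u -> Q x -> Q (u * x)) -> forall x, x \in subalg X -> Q x.
Proof.
move=> QP Q0 Q1 QM; apply: agenv_ind => // u x Xu Qx; move: u Xu.
apply: vspan_ind => [|a u v Qu Qv|u Xu]; rewrite ?mul0r //; last exact: QM.
by rewrite mulrDl -scalerAl; apply: QP.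
Qed.

Section DrinfeldDouble.
Variables (k : fieldType) (gT : finGroupType) (V : vectType k) (YV : ydMod gT V).
Variables (B : falgType k) (NB : nichols YV B).
Variables (H : falgType k) (hH : hopf H) (bH : bosonization NB hH).
Variables (D : falgType k) (dD : drinfeldDouble hH D).
Local Notation Bd := 'Hom(B, k^o).
Local Notation Hd := 'Hom(H, k^o).
Local Notation deg := (ndeg NB).
Local Notation grp := (bos_grp bH).
Local Notation alg := (bos_alg bH).
Local Notation "b # g" := (alg b * grp g) (at level 40).
Local Notation co := (ycoact (nyd NB)).

(** The summand of [ddM] as a function of the three Sweedler legs [x], [y], [z] of the right factor.
    Its linearity in each leg lets [tlift_purE] evaluate [ddM] on explicit coproducts. *)
Let dprod (h : H) (f f' : Hd) (x y z : H) : D :=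
  dd dD (tpure (h * y) (dual_mul hH f' (dual_hit x f (hant hH z)))).

Lemma dd_tpureDr h a (f f' : Hd) :
  dd dD (tpure h (a *: f + f')) = a *: dd dD (tpure h f) + dd dD (tpure h f').
Proof. by rewrite -linearP -tpureDr. Qed.

Lemma dd_tpureDl h a h' (f : Hd) :
  dd dD (tpure (a *: h + h') f) = a *: dd dD (tpure h f) + dd dD (tpure h' f).
Proof. by rewrite -linearP -tpureDl. Qed.

Lemma dprod_linl h f f' y z : linear (fun x => dprod h f f' x y z).
Proof.
move=> a u v; rewrite /dprod -dd_tpureDr -dual_mul_linr.
congr (dd dD (tpure _ (dual_mul _ _ _))).
apply/lfunP => x; rewrite add_lfunE scale_lfunE !dual_hitE !mulrDl -!scalerAl.
by rewrite linearP.
Qed.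

Lemma dprod_linm h f f' x z : linear (fun y => dprod h f f' x y z).
Proof. by move=> a u v; rewrite /dprod -dd_tpureDl mulrDr -scalerAr. Qed.

Lemma dprod_linr h f f' x y : linear (fun z => dprod h f f' x y z).
Proof.
move=> a u v; rewrite /dprod -dd_tpureDr -dual_mul_linr.
congr (dd dD (tpure _ (dual_mul _ _ _))).
apply/lfunP => w; rewrite add_lfunE scale_lfunE !dual_hitE linearP mulrDr.
by rewrite -scalerAr linearP.
Qed.

Lemma dprod_bilin12 h f f' z : bilin (fun x y => dprod h f f' x y z).
Proof. by split=> [y|x]; [apply: dprod_linl|apply: dprod_linm]. Qed.

Lemma dprod_bilin h f f' :
  bilin (fun u z => tlift (fun x y => dprod h f f' x y z) (hcop hH u)).
Proof.
split=> [z a u v|u a z z']; first by rewrite !linearP.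
rewrite /tlift scaler_sumr -big_split; apply: eq_bigr => i _ /=.
rewrite scaler_sumr -big_split; apply: eq_bigr => j _ /=.
by rewrite dprod_linr scalerDr !scalerA mulrC.
Qed.

Lemma ddM_grpr h x f f' :
  dd dD (tpure h f) * dd dD (tpure (grp x) f') =
  dd dD (tpure (h * grp x) (grp_twist bH x f f')).
Proof.
rewrite ddM bos_cop_grp tlift_purE; last exact: dprod_bilin.
rewrite bos_cop_grp tlift_purE; last exact: dprod_bilin12.
by rewrite /grp_twist bos_ant_grp.
Qed.

Lemma dual_mul1l (f : Hd) : dual_mul hH (hcou hH) f = f.
Proof. exact: (conv1l (hopf_coalg hH)). Qed.

Lemma dual_mul1r (f : Hd) : dual_mul hH f (hcou hH) = f.
Proof. exact: (conv1r (hopf_coalg hH)). Qed.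

Lemma dual_hit1 (f : Hd) : dual_hit 1 f 1 = f.
Proof. by apply/lfunP => x; rewrite dual_hitE mul1r mulr1. Qed.

Lemma dual_hit_cou x : dual_hit (grp x) (hcou hH) (grp x^-1%g) = hcou hH.
Proof.
apply/lfunP => y; rewrite dual_hitE !hcouM !bos_cou_grp mul1r.
exact: mulr1.
Qed.

Lemma dd_split h f : dd dD (tpure h f) = dd_alg dD h * dd_dual dD f.
Proof.
rewrite /dd_alg /dd_dual -(bos_grp1 bH) ddM_grpr bos_grp1 mulr1.
by rewrite /grp_twist dual_hit_cou dual_mul1r.
Qed.

(** The factors are swapped because the double contains the opposite algebra of the dual. *)
Lemma dd_dualM f f' : dd_dual dD f * dd_dual dD f' = dd_dual dD (dual_mul hH f' f).
Proof.
rewrite /dd_dual -(bos_grp1 bH) ddM_grpr -bos_grpM mulg1 /grp_twist.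
by rewrite invg1 bos_grp1 dual_hit1.
Qed.

Lemma dd_alg_is_linear : linear (dd_alg dD).
Proof. by move=> a x y; rewrite /dd_alg dd_tpureDl. Qed.
HB.instance Definition _ := GRing.isLinear.Build k H D _ (dd_alg dD) dd_alg_is_linear.

Lemma dd_dual_is_linear : linear (dd_dual dD).
Proof. by move=> a x y; rewrite /dd_dual dd_tpureDr. Qed.
HB.instance Definition _ := GRing.isLinear.Build k Hd D _ (dd_dual dD) dd_dual_is_linear.

Lemma dd_alg_grpr h x : dd_alg dD h * dd_alg dD (grp x) = dd_alg dD (h * grp x).
Proof.
by rewrite /dd_alg ddM_grpr /grp_twist dual_hit_cou dual_mul1l.
Qed.

Lemma bilin_hcop g :
  bilin (fun b1 b2 => \sum_(t : gT) tpure (b1 # (t * g)%g) (co t b2 # g) : tens H H).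
Proof.
apply: bilin_sum => t.
have l1 : linear (fun u : B => u # (t * g)%g).
  by move=> a u v; rewrite linearP mulrDl -scalerAl.
have l2 : linear (fun u : B => co t u # g).
  by move=> a u v; rewrite !linearP mulrDl -scalerAl.
exact: (@bilin_comp k B B H H _ _ (mk_linear l1) (mk_linear l2) (@bilin_tpure k H H)).
Qed.

Lemma hcop_prim v : v \in deg 1 ->
  hcop hH (alg v) = tpure (alg v) 1 + \sum_t tpure (grp t) (alg (co t v)).
Proof.
move=> v1; have vp := (ndeg1_prim NB v).1 v1.
rewrite (bos_algE bH v) hcop_bos vp linearD /= !tlift_purE; try exact: bilin_hcop.
rewrite (bos_grp1 bH) !mulr1; congr (_ + _).
  rewrite (bigD1 1%g) //= ncoact1 rmorph1 mul1r mulg1 bos_grp1 mulr1.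
  rewrite big1 ?addr0 ?mulr1 // => t /negPf t1.
  by rewrite -(ncoact1 NB) ycoactK t1 linear0 mul0r tpure0r.
by apply: eq_bigr => t _; rewrite rmorph1 mul1r mulg1 mulr1.
Qed.

Lemma ncou_prim v : v \in deg 1 -> ncou NB v = 0.
Proof. by move=> v1; apply: ndeg_cou v1 _. Qed.

Lemma hant_prim v : v \in deg 1 ->
  hant hH (alg v) = - \sum_t grp t^-1%g * alg (co t v).
Proof.
move=> v1; have [+ _] := hantP hH (alg v).
have bs : bilin (fun x y => hant hH x * y).
  by split=> [y|x] a u w; rewrite ?linearP ?mulrDl ?mulrDr -?scalerAl -?scalerAr.
rewrite hcop_prim // linearD linear_sum /= tlift_purE // mulr1.
rewrite bos_cou_alg ncou_prim // scale0r => /eqP; rewrite addr_eq0 => /eqP ->.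
by congr (- _); apply: eq_bigr => t _; rewrite tlift_purE // bos_ant_grp.
Qed.

(** The three terms are those of the iterated coproduct of [v]: v (x) 1 (x) 1, the sum of t (x) v_t
    (x) 1, and the sum of t (x) t (x) v_t, with v_t the component of [v] of coaction degree t. *)
Lemma dd_alg_primr h f v : v \in deg 1 ->
  dd dD (tpure h f) * dd_alg dD (alg v) =
  dd dD (tpure h (dual_hit (alg v) f 1)) +
  \sum_t dd dD (tpure (h * alg (co t v)) (dual_hit (grp t) f 1)) +
  \sum_t dd dD (tpure (h * grp t) (dual_hit (grp t) f (hant hH (alg (co t v))))).
Proof.
move=> v1; have ant1 : hant hH 1 = 1.
  by rewrite -(bos_grp1 bH) bos_ant_grp invg1.
rewrite /dd_alg ddM hcop_prim // linearD linear_sum /=.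
rewrite tlift_purE; last exact: dprod_bilin.
rewrite hcop_prim // linearD linear_sum /= tlift_purE; last exact: dprod_bilin12.
rewrite mulr1 dual_mul1l; congr (_ + _ + _); first by rewrite ant1.
  apply: eq_bigr => t _.
  rewrite tlift_purE; last exact: dprod_bilin12.
  by rewrite ant1 dual_mul1l.
apply: eq_bigr => t _; rewrite tlift_purE; last exact: dprod_bilin.
rewrite bos_cop_grp tlift_purE; last exact: dprod_bilin12.
by rewrite dual_mul1l.
Qed.

Lemma dd_tpure0r h : dd dD (tpure h 0) = 0.
Proof. by rewrite tpure0r linear0. Qed.

Lemma dd_alg_prim h v : v \in deg 1 ->
  dd_alg dD h * dd_alg dD (alg v) = dd_alg dD (h * alg v).
Proof.
move=> v1; rewrite [dd_alg dD h]/dd_alg dd_alg_primr //.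
have -> : dual_hit (alg v) (hcou hH) 1 = 0.
  apply/lfunP => x; rewrite dual_hitE !hcouM bos_cou_alg ncou_prim //.
  by rewrite mul0r mul0r zero_lfunE.
rewrite dd_tpure0r add0r [X in _ + X]big1 ?addr0 => [|t _].
  rewrite -[in RHS](ycoact_sum (nyd NB) v) linear_sum mulr_sumr linear_sum.
  apply: eq_bigr => t _; congr (dd dD (tpure _ _)); apply/lfunP => x.
  by rewrite dual_hitE !hcouM bos_cou_grp hcou1 mul1r; apply: mulr1.
suff -> : dual_hit (grp t) (hcou hH) (hant hH (alg (co t v))) = 0 by rewrite dd_tpure0r.
apply/lfunP => x; rewrite dual_hitE hcouM hant_prim ?ndeg_coact //.
rewrite linearN linear_sum /= big1 ?oppr0 ?mulr0 ?zero_lfunE // => u _.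
rewrite hcouM bos_cou_alg ncou_prim ?mulr0 // !ndeg_coact //.
Qed.

Lemma nichols_gen_ind (Q : B -> Prop) :
  (forall a x y, Q x -> Q y -> Q (a *: x + y)) -> Q 0 -> Q 1 ->
  (forall v b, v \in deg 1 -> Q b -> Q (v * b)) -> forall b, Q b.
Proof.
move=> QP Q0 Q1 QM b; apply: (agenv_ind (U := deg 1)) => //.
by rewrite ndeg1_gen memvf.
Qed.

(** Only degree 1 needs a computation with the double, done in [dd_alg_prim]; generation by degree 1
    and associativity in [D] and [H] do the rest. *)
Lemma dd_algM h b : dd_alg dD h * dd_alg dD (alg b) = dd_alg dD (h * alg b).
Proof.
move: b h; apply: nichols_gen_ind => [a x y Qx Qy h|h|h|v b v1 Qb h].
- by rewrite !linearP !mulrDr -!scalerAr Qx Qy linearP.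
- by rewrite !linear0 !mulr0 linear0.
- by rewrite rmorph1 [dd_alg dD 1](dd1 dD) !mulr1.
by rewrite rmorphM -Qb mulrA dd_alg_prim // Qb mulrA.
Qed.

Lemma dd_grp_left b F : dd_alg dD (alg b) * dd_grp bH dD F =
  \sum_x dd dD (tpure (b # x) (F x)).
Proof.
rewrite mulr_sumr; apply: eq_bigr => x _.
by rewrite (dd_split (grp x)) mulrA dd_alg_grpr -dd_split.
Qed.

Lemma dd_ind (P : D -> Prop) : (forall x y, P x -> P y -> P (x + y)) ->
  (forall b F, P (dd_alg dD (alg b) * dd_grp bH dD F)) -> forall d, P d.
Proof.
move=> PD Pp d; have [inv _ invK] := dd_bij dD; rewrite -[d]invK; move: (inv d) => t.
have P0 : P 0 by have := Pp 0 0; rewrite !linear0 mul0r.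
have Pt h f : P (dd dD (tpure h f)).
  move: h; apply: (bos_ind (bH := bH)) => [x y Px Py|b g].
    by rewrite -[x]scale1r dd_tpureDl scale1r; apply: PD.
  have := Pp b (dd_single g f); rewrite dd_grp_left (bigD1 g) //= ffunE eqxx.
  rewrite big1 ?addr0 // => x /negPf xg; by rewrite ffunE xg dd_tpure0r.
rewrite -[t]tlift_tpure /tlift linear_sum; apply: (big_ind P) => // i _.
rewrite linear_sum; apply: (big_ind P) => // j _.
rewrite linearZ /=; set u := _`_i; set f := _`_j.
by have := Pt u (t i j *: f + 0); rewrite dd_tpureDr dd_tpure0r addr0.
Qed.

(* The projection of D = B (x) kG (x) H^* onto kG (x) H^* along B^{>0}. *)
Definition dd_top_coef (d : D) : {ffun gT -> Hd} :=
  [ffun x => tlift (fun h f => dual_grp bH (fun g => (g == x)%:R) h *: f)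
     ((dd dD)^-1%VF d)].

Lemma dd_top_coef_linear : linear dd_top_coef.
Proof. by move=> a d e; apply/ffunP => x; rewrite !ffunE !linearP. Qed.
HB.instance Definition _ :=
  GRing.isLinear.Build k D {ffun gT -> Hd} _ dd_top_coef dd_top_coef_linear.

Lemma dd_top_coefD d e : dd_top_coef (d + e) = dd_top_coef d + dd_top_coef e.
Proof. exact: linearD. Qed.

Definition dd_top (d : D) : D := dd_grp bH dD (dd_top_coef d).

Lemma dd_top_linear : linear dd_top.
Proof. by move=> a d e; rewrite /dd_top !linearP. Qed.
HB.instance Definition _ := GRing.isLinear.Build k D D _ dd_top dd_top_linear.

Lemma dd_topE b F :
  dd_top (dd_alg dD (alg b) * dd_grp bH dD F) = ncou NB b *: dd_grp bH dD F.
Proof.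
have -> : ncou NB b *: dd_grp bH dD F = dd_grp bH dD ((ncou NB b : k) *: F).
  by rewrite linearZ.
rewrite dd_grp_left /dd_top; congr (dd_grp _ _ _).
apply/ffunP => x; rewrite !ffunE !linear_sum (bigD1 x) //= lker0_lfunK; last first.
  by apply/lker0P; exact: (bij_inj (dd_bij dD)).
have bl g : bilin (fun h (f : Hd) => dual_grp bH (fun y => (y == g)%:R) h *: f).
  split=> [f a u v|h a f f']; first by rewrite linearP scalerDl scalerA.
  by rewrite scalerDr !scalerA mulrC.
rewrite tlift_purE // bos_funE eqxx scale1r big1 ?addr0 // => g /negPf gx.
rewrite lker0_lfunK; last by apply/lker0P; exact: (bij_inj (dd_bij dD)).
by rewrite tlift_purE // bos_funE gx scale0r zero_lfunE scale0r.
Qed.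

Lemma dd_top_grp F : dd_top (dd_grp bH dD F) = dd_grp bH dD F.
Proof.
have := dd_topE 1 F; rewrite rmorph1 [dd_alg dD 1](dd1 dD) mul1r => ->.
by rewrite ncou1 scale1r.
Qed.

Lemma dd_topMr d F : dd_top (d * dd_grp bH dD F) = dd_top d * dd_grp bH dD F.
Proof.
move: d; apply: dd_ind => [x y Px Py|b G].
  by rewrite mulrDl !linearD /= Px Py mulrDl.
by rewrite -mulrA dd_grpM !dd_topE -scalerAl dd_grpM.
Qed.

Lemma dd_topMalg b d : dd_top (dd_alg dD (alg b) * d) = ncou NB b *: dd_top d.
Proof.
move: d; apply: dd_ind => [x y Px Py|c F].
  by rewrite mulrDr !linearD /= Px Py.
by rewrite mulrA dd_algM -rmorphM !dd_topE ncouM scalerA.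
Qed.

(** * Left D(G)-linearity of the projection *)

Lemma dualG_bos chi b g : in_dualG bH chi ->
  chi (b # g) = (ncou NB b * chi (grp g) : k).
Proof.
move=> chiG; move: b; apply: (@ndeg_ind _ _ _ _ _ NB) => [|a b|m b bm].
- by rewrite !linear0 mul0r linear0 mul0r.
- by move=> Pa Pb; rewrite !linearD /= !mulrDl linearD /= Pa Pb.
have [m0|m0] := eqVneq m 0%N; last first.
  by rewrite (chiG m) // (ndeg_cou bm) ?lt0n // mul0r.
move: bm; rewrite m0 ndeg0 => /vlineP[c ->].
rewrite !linearZ /= rmorph1 -scalerAl mul1r linearZ /= ncou1.
by rewrite /GRing.scale /= mulr1.
Qed.

(** Such a [chi] is the counit of [B] times a function on [G]. Moving group elements to the right
    leaves [v], acted on by [G], as a factor under that counit, which is multiplicative and vanishes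
    on it. *)
Lemma dualG_prim chi x v y : in_dualG bH chi -> v \in deg 1 ->
  chi (x * alg v * y) = 0.
Proof.
move=> chiG v1; move: x y; apply: (bos_ind (bH := bH)) => [x x' Px Px' y|b g].
  by rewrite !mulrDl linearD /= Px Px' addr0.
apply: (bos_ind (bH := bH)) => [y y' Py Py'|b' g'].
  by rewrite !mulrDr linearD /= Py Py' addr0.
have E : b # g * alg v * (b' # g') =
    (b * yact (nyd NB) g (v * b')) # (g * g')%g.
  rewrite -!mulrA (mulrA (alg v)) -rmorphM (mulrA (grp g)) bos_comm.
  by rewrite rmorphM bos_grpM !mulrA.
rewrite [X in fun_of_lfun _ X]E.
by rewrite dualG_bos // ncouM ncou_act ncouM (ncou_prim v1) mul0r mulr0 mul0r.
Qed.

Lemma dd_top_dualG chi d : in_dualG bH chi ->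
  dd_top (dd_dual dD chi * d) = dd_dual dD chi * dd_top d.
Proof.
move=> chiG; move: d; apply: dd_ind => [x y Px Py|b F].
  by rewrite mulrDr !linearD /= Px Py mulrDr.
move: b F; apply: nichols_gen_ind => [a x y Qx Qy F|F|F|v b v1 _ F].
- rewrite !linearP /= mulrDl mulrDr -!scalerAl -scalerAr !linearP /= Qx Qy.
  by rewrite mulrDr -scalerAr.
- by rewrite !linear0 mul0r mulr0 linear0 mulr0.
- rewrite rmorph1 [dd_alg dD 1](dd1 dD) mul1r (dd_dualE bH) dd_grpM.
  by rewrite !dd_top_grp dd_grpM.
(* With a degree 1 factor [v] on the left of [b] both sides vanish. Of the three terms of
   [dd_alg_primr], the outer two evaluate [chi] on a product containing a degree 1 element, and the
   middle one has such an element on the far left, where the projection kills it. *)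
have -> : dd_top (dd_alg dD (alg (v * b)) * dd_grp bH dD F) = 0.
  by rewrite dd_topE ncouM (ncou_prim v1) mul0r scale0r.
rewrite mulr0 rmorphM -dd_algM !mulrA [dd_dual dD chi]/dd_dual dd_alg_primr //.
have -> : dual_hit (alg v) chi 1 = 0.
  apply/lfunP => x; rewrite dual_hitE zero_lfunE.
  by have := dualG_prim 1 (x * 1) chiG v1; rewrite mul1r mulrA.
rewrite dd_tpure0r add0r [X in _ + X]big1 ?addr0 => [|t _].
  rewrite !mulr_suml linear_sum big1 // => t _.
  rewrite /= dd_split -!mulrA mul1r dd_topMalg ncou_prim ?ndeg_coact //.
  by rewrite scale0r.
suff -> : dual_hit (grp t) chi (hant hH (alg (co t v))) = 0 by rewrite dd_tpure0r.
apply/lfunP => x; rewrite dual_hitE hant_prim ?ndeg_coact // zero_lfunE.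
rewrite mulrN linearN mulr_sumr linear_sum big1 ?oppr0 // => u _.
have u1 : co u (co t v) \in deg 1 by rewrite !ndeg_coact.
by have := dualG_prim (grp t * x * grp u^-1%g) 1 chiG u1; rewrite mulr1 mulrA.
Qed.

Lemma dd_top_DG z d : z \in subalg (DG_gens bH dD) -> dd_top (z * d) = z * dd_top d.
Proof.
move=> zG; move: z zG d; apply: subalg_ind => [a x y Qx Qy d|d|d|u x].
- by rewrite !mulrDl -!scalerAl linearP /= Qx Qy.
- by rewrite !mul0r linear0.
- by rewrite !mul1r.
move=> Xu Qx d; rewrite -!mulrA -Qx; move: (x * d) => {Qx x d} d.
case: Xu => [[g ->]|[chi chiG ->]]; last exact: dd_top_dualG.
move: d; apply: dd_ind => [x y Px Py|b F].
  by rewrite mulrDr !linearD /= Px Py mulrDr.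
rewrite mulrA dd_algM bos_comm -dd_alg_grpr -mulrA dd_algE dd_grpM !dd_topE.
by rewrite ncou_act -dd_grpM scalerAr.
Qed.

(** * D^{>= 0} contains all of kG (x) H^* *)

(** The functionals sent into D^{>= 0} form a convolution-closed subspace with the counit and all
    those concentrated in degree 1, which are the elements of \overline V; [conv_generated]
    applies. *)
Lemma bos_fun_const_Dge0 (phi : Bd) :
  dd_dual dD (bos_fun bH (fun=> phi)) \in subalg (Dge0_gens bH dD).
Proof.
have Jlin : linear (fun phi : Bd => dd_dual dD (bos_fun bH (fun=> phi))).
  move=> a f f'; rewrite -linearP; congr (dd_dual _ _).
  apply: (bos_fun_ext (bH := bH)) => b g.
  by rewrite add_lfunE scale_lfunE !bos_funE add_lfunE scale_lfunE.
pose J : {linear Bd -> D} := mk_linear Jlin.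
pose T := (linfun J @^-1: subalg (Dge0_gens bH dD))%VS.
have TP f : (f \in T) = (dd_dual dD (bos_fun bH (fun=> f)) \in subalg (Dge0_gens bH dD)).
  by rewrite -memv_preim lfunE.
rewrite -TP; apply: (conv_generated (NB := NB)) => [|f f1|f g].
- rewrite TP; have -> : bos_fun bH (fun=> ncou NB) = hcou hH.
    apply: (bos_fun_ext (bH := bH)) => b g.
    by rewrite bos_funE hcouM bos_cou_alg bos_cou_grp mulr1.
  by rewrite [dd_dual dD _](dd1 dD) subalg1.
- rewrite TP; apply: subalg_gen; right; exists (bos_fun bH (fun=> f)) => //.
  split=> [m b g bm m1|v g]; last by rewrite [in RHS](bos_algE bH) !bos_funE.
  by rewrite bos_funE (f1 m).
rewrite !TP => Tf Tg; rewrite -dual_mul_bos_fun -dd_dualM.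
by apply: memvM.
Qed.

Lemma dd_grp_Dge0 F : dd_grp bH dD F \in subalg (Dge0_gens bH dD).
Proof.
apply: rpred_sum => x _; rewrite dd_split; apply: memvM.
  by apply: subalg_gen; left; left; exists x.
have [phi ->] := bos_fun_rep bH (F x); rewrite bos_fun_dual_mul linear_sum.
apply: rpred_sum => g _; rewrite /= -dd_dualM; apply: memvM.
  by apply: subalg_gen; left; right; exists (dual_grp bH (fun y => (y == g)%:R));
    rewrite //; apply: dual_grp_in.
exact: bos_fun_const_Dge0.
Qed.

Lemma dd_top_coefMalg b d :
  dd_top_coef (dd_alg dD (alg b) * d) = (ncou NB b : k) *: dd_top_coef d.
Proof.
apply: (can_inj (dd_grpK bH dD)).
have -> : dd_grp bH dD ((ncou NB b : k) *: dd_top_coef d) = ncou NB b *: dd_top d.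
  by rewrite linearZ.
exact: dd_topMalg.
Qed.

Lemma dd_top_coefMr d F :
  dd_top_coef (d * dd_grp bH dD F) = grp_mul bH (dd_top_coef d) F.
Proof. by apply: (can_inj (dd_grpK bH dD)); rewrite -dd_grpM; apply: dd_topMr. Qed.

Lemma dd_top_coef_DG F d : dd_grp bH dD F \in subalg (DG_gens bH dD) ->
  dd_top_coef (dd_grp bH dD F * d) = grp_mul bH F (dd_top_coef d).
Proof.
by move=> FG; apply: (can_inj (dd_grpK bH dD)); rewrite -dd_grpM; apply: dd_top_DG.
Qed.

Lemma dd_top_coef_grp F : dd_top_coef (dd_grp bH dD F) = F.
Proof. by apply: (can_inj (dd_grpK bH dD)); apply: dd_top_grp. Qed.

End DrinfeldDouble.

(** * The simple modules of D(G) *)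

Section WeightModules.
Variables (k : fieldType) (gT : finGroupType) (V : vectType k) (YV : ydMod gT V).
Variables (B : falgType k) (NB : nichols YV B).
Variables (H : falgType k) (hH : hopf H) (bH : bosonization NB hH).
Variables (D : falgType k) (dD : drinfeldDouble hH D).
Local Notation Hd := 'Hom(H, k^o).
Local Notation grp := (bos_grp bH).
Local Notation alg := (bos_alg bH).
Variables (g : gT) (n : nat) (rG : mx_representation k 'C[g]%g n).
Local Notation U := 'rV[k]_n.
Local Notation pi := (quotpi (gensub_submod (kGU_rel rG))).

(** The action on M(g,rho) in coordinates, free of any generating set: the structures over D(G) and
    over D^{>= 0} are both restrictions of it, by [Mgr_wt_act]. *)
Definition wt_act (F : {ffun gT -> Hd}) (m : kGCU rG) : kGCU rG :=
  quotlift (gensub_submod (kGU_rel rG)) (kGU_act bH g F) m.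

Lemma wt_actE F p : wt_act F (pi p) = pi (kGU_act bH g F p).
Proof. by rewrite /wt_act quotliftE //; apply: kGU_act_stable. Qed.

Lemma wt_actM F F' m : wt_act (grp_mul bH F F') m = wt_act F (wt_act F' m).
Proof. by rewrite -[m]quotreprK !wt_actE kGU_actM. Qed.

Lemma wt_actDl a F F' m : wt_act (a *: F + F') m = a *: wt_act F m + wt_act F' m.
Proof. by rewrite -[m]quotreprK !wt_actE kGU_actDl quotpi_linear. Qed.

Lemma wt_actZl a F m : wt_act (a *: F) m = a *: wt_act F m.
Proof.
have := wt_actDl 1 0 0 m; rewrite !scale1r addr0 => /esym E.
have F0 : wt_act 0 m = 0 by apply: (addrI (wt_act 0 m)); rewrite addr0.
by rewrite -[a *: F]addr0 wt_actDl F0 addr0.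
Qed.

Lemma wt_act0l m : wt_act 0 m = 0.
Proof. by rewrite -(scale0r 0) wt_actZl scale0r. Qed.

Lemma wt_actDr a F m m' : wt_act F (a *: m + m') = a *: wt_act F m + wt_act F m'.
Proof.
rewrite -[m]quotreprK -[m']quotreprK -quotpi_linear !wt_actE.
by rewrite kGU_act_linear quotpi_linear.
Qed.

Lemma wt_act_addl F F' m : wt_act (F + F') m = wt_act F m + wt_act F' m.
Proof. by rewrite -[F in LHS]scale1r wt_actDl scale1r. Qed.

Lemma wt_act_addr F m m' : wt_act F (m + m') = wt_act F m + wt_act F m'.
Proof. by rewrite -[m in LHS]scale1r wt_actDr scale1r. Qed.

Lemma wt_act0r F : wt_act F 0 = 0.
Proof. by apply: (addrI (wt_act F 0)); rewrite -wt_act_addr !addr0. Qed.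

Lemma wt_act1 m : wt_act (dd_single 1%g (hcou hH)) m = m.
Proof. by rewrite -[m]quotreprK wt_actE kGU_act1. Qed.

Lemma Mgr_wt_act X (hX : forall d, X d -> exists F, d = dd_grp bH dD F)
    (a : subvs_of (subalg X)) (m : Mgr_on rG hX) F :
  vsval a = dd_grp bH dD F -> a *: m = wt_act F m.
Proof.
move=> aF; rewrite -[m](quotreprK (cP := gensub_submod (kGU_rel rG))).
by rewrite wt_actE; apply: Mgr_scaleE.
Qed.

Lemma kGU_sum (p : kGU k gT n) : p = \sum_y kGU_pure y (p y).
Proof.
apply/ffunP => z; rewrite sum_ffunE (bigD1 z) //= ffunE eqxx big1 ?addr0 // => y.
by rewrite ffunE eq_sym => /negPf ->.
Qed.

Lemma kGU_pure_linear y : linear (kGU_pure y : U -> kGU k gT n).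
Proof.
move=> a u v; apply/ffunP => z; rewrite !ffunE.
by case: eqP; rewrite ?scaler0 ?addr0.
Qed.

Lemma pi_pure_cent y c u : c \in 'C[g]%g ->
  pi (kGU_pure (y * c)%g u) = pi (kGU_pure y (u *m rG c^-1%g)).
Proof. by move=> cC; apply/quotpiP; apply: mem_gensub; exists y, c, u. Qed.

(* Projects k[G] (x) U onto the functions p with p (z c) = p z rG(c); its values
   decide equality in k[G] (x)_{k C_g} U. *)
Definition cent_sum (p : kGU k gT n) (z : gT) : U :=
  \sum_(c in 'C[g]%g) p (z * c)%g *m rG c^-1%g.

Lemma cent_sum_linear z : linear (cent_sum^~ z : kGU k gT n -> U).
Proof.
move=> a p q; rewrite /cent_sum scaler_sumr -big_split; apply: eq_bigr => c _ /=.
by rewrite !ffunE mulmxDl scalemxAl.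
Qed.

Lemma cent_sum_pure z y u : cent_sum (kGU_pure y u) z =
  if (z^-1 * y)%g \in 'C[g]%g then u *m rG (y^-1 * z)%g else 0.
Proof.
have E c : (kGU_pure y u (z * c)%g = if c == (z^-1 * y)%g then u else 0).
  by rewrite ffunE -(can2_eq (mulKg z) (mulKVg z)).
rewrite /cent_sum; under eq_bigr => c _ do rewrite E.
case: ifP => [zyC|zyC]; last first.
  rewrite big1 // => c cC; case: eqP => [cE|_]; last by rewrite mul0mx.
  by rewrite cE zyC in cC.
rewrite (bigD1 (z^-1 * y)%g) //= eqxx big1 ?addr0 => [|c /andP[_ /negPf ->]].
  by rewrite invMg invgK.
by rewrite mul0mx.
Qed.

Lemma cent_sum_rel p z : p \in gensub (kGU_rel rG) -> cent_sum p z = 0.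
Proof.
pose L : {linear kGU k gT n -> U} := mk_linear (cent_sum_linear z).
suff sub : {subset gensub (kGU_rel rG) <= [pred p | L p == 0]}.
  by move=> /sub; rewrite inE => /eqP.
apply: gensubP => [|_ [y [c [u [cC ->]]]]]; first exact: ker_submod.
rewrite inE linearB /= !cent_sum_pure mulgA groupMr //.
case: ifP => zyC; rewrite ?subrr //.
rewrite -mulmxA -repr_mxM ?groupV //; last by rewrite -groupV invMg invgK.
by rewrite invMg mulgA subrr.
Qed.

Let piL : {linear kGU k gT n -> kGCU rG} :=
  mk_linear (quotpi_linear (gensub_submod (kGU_rel rG))).
Let pureL y : {linear U -> kGU k gT n} := mk_linear (kGU_pure_linear y).

Lemma pi_pure_sum (A : {set gT}) (p : kGU k gT n) z :
  A = 'C[g]%g :> {set gT} ->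
  \sum_(c in A) pi (kGU_pure (z * c)%g (p (z * c)%g)) =
  pi (kGU_pure z (cent_sum p z)).
Proof.
move=> ->; rewrite /cent_sum -[kGU_pure z _]/(pureL z _) linear_sum -[RHS]/(piL _).
by rewrite linear_sum; apply: eq_bigr => c cC; apply: pi_pure_cent.
Qed.

(** Summing the classes of z (x) [cent_sum p z] over all z counts each term of [p] once for every
    element of C_g; the order of C_g is invertible in characteristic zero. *)
Lemma cent_sum_eq0 (p : kGU k gT n) : [pchar k] =i pred0 ->
  (forall z, cent_sum p z = 0) -> pi p = 0.
Proof.
move=> char0 p0.
have cN0 : (#|'C[g]%g|%:R : k) != 0.
  by rewrite (pcharf0P _).1 // -lt0n cardG_gt0.
apply: (scalerI cN0); rewrite scaler0.
have <- : \sum_z pi (kGU_pure z (cent_sum p z)) = 0.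
  rewrite big1 // => z _; rewrite p0 -[kGU_pure z _]/(pureL z _) linear0.
  exact: quotpi0.
under [RHS]eq_bigr => z _ do rewrite -(pi_pure_sum p z erefl).
rewrite exchange_big /= scaler_nat -sumr_const; apply: eq_bigr => c _.
rewrite [in LHS](kGU_sum p) -[LHS]/(piL _) linear_sum.
by rewrite [LHS](reindex_inj (mulIg c)).
Qed.

Lemma pi_pure_eq0 y u : pi (kGU_pure y u) = 0 -> u = 0.
Proof.
rewrite -(quotpi0 (gensub_submod (kGU_rel rG))) => /quotpiP.
rewrite subr0 => /(cent_sum_rel y); rewrite cent_sum_pure mulVg group1.
by rewrite repr_mx1 mulmx1.
Qed.

(** An indicator function in k^G cuts a nonzero vector down to one coset of C_g, and translation
    turns it into 1 (x) u with u nonzero. Irreducibility then gives all of 1 (x) U, and translations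
    give the rest. *)
Lemma DG_weight_simple : [pchar k] =i pred0 -> mx_irreducible rG ->
  simple_module (DG_weight bH dD rG).
Proof.
move=> char0 irr; have [_ U0 _] := irr; split=> //.
  have [u u0] : exists u : U, u != 0.
    have /rowV0Pn[u _ u0] := U0; by exists u.
  exists (pi (kGU_pure 1%g u)) => //.
  by apply: contra u0 => /eqP /pi_pure_eq0 ->.
move=> P cP _; have [|] := boolP `[< exists2 x, x \in P & x != 0 >]; last first.
  move=> /asboolPn nP; left=> x Px; apply: contrapT => /eqP x0; apply: nP.
  by exists x.
case/asboolP=> x Px x0; right.
have Pact d F (m : kGCU rG) : DG_gens bH dD d -> d = dd_grp bH dD F ->
    (m : DG_weight bH dD rG) \in P -> (wt_act F m : DG_weight bH dD rG) \in P.
  move=> dG dF Pm; pose a : subvs_of (subalg (DG_gens bH dD)) := Subvs (subalg_gen dG).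
  rewrite -(@Mgr_wt_act _ (DG_gens_dd_grp (dD:=dD)) a) //.
  exact: submodZ.
have Pgrp y m : (m : DG_weight bH dD rG) \in P ->
    (wt_act (dd_single y (hcou hH)) m : DG_weight bH dD rG) \in P.
  by apply: (Pact (dd_alg dD (grp y))); [left; exists y|rewrite dd_algE].
have Pdual chi m : (m : DG_weight bH dD rG) \in P ->
    (wt_act (dd_single 1%g (dual_grp bH chi)) m : DG_weight bH dD rG) \in P.
  apply: (Pact (dd_dual dD (dual_grp bH chi))); last by rewrite (dd_dualE bH).
  by right; exists (dual_grp bH chi) => //; apply: dual_grp_in.
have PD (m m' : kGCU rG) : (m : DG_weight bH dD rG) \in P ->
    (m' : DG_weight bH dD rG) \in P -> (m + m' : DG_weight bH dD rG) \in P.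
  exact: submodD.
have actpure chi p : kGU_act bH g (dd_single 1%g (dual_grp bH chi)) p =
    [ffun z => chi (z * g * z^-1)%g *: p z].
  apply/ffunP=> z; rewrite !ffunE (bigD1 1%g) //= ffunE eqxx dual_grpE.
  rewrite invg1 mul1g mulg1 big1 ?addr0 // => y /negPf; rewrite ffunE => ->.
  by rewrite zero_lfunE scale0r.
have Ptrans y z u : (pi (kGU_pure z u) : DG_weight bH dD rG) \in P ->
    (pi (kGU_pure (y * z)%g u) : DG_weight bH dD rG) \in P.
  by move=> /(Pgrp y); rewrite wt_actE kGU_act_single bos_cou_grp scale1r.
have [u Pu u0] : exists2 u : U,
    (pi (kGU_pure 1%g u) : DG_weight bH dD rG) \in P & u != 0.
  move: x0; rewrite -[x](quotreprK (cP := gensub_submod (kGU_rel rG))) => x0.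
  set p := quotrepr x in x0.
  have [z cz] : exists z, cent_sum p z != 0.
    apply: contrapT => nz; case/eqP: x0; apply: cent_sum_eq0 => // z.
    by apply: contrapT => /eqP cz; apply: nz; exists z.
  exists (cent_sum p z) => //; rewrite -(mulVg z); apply: Ptrans.
  (* The elements conjugating g to z g z^-1 form the coset z C_g, so [chi] keeps just the part of
     [p] on this coset. *)
  pose chi (y : gT) : k := (y == z * g * z^-1)%g%:R.
  have := Pdual chi x Px; rewrite -{1}[x](quotreprK (cP := gensub_submod (kGU_rel rG))).
  rewrite wt_actE actpure -(pi_pure_sum p z erefl) -/p.
  congr (_ \in P); rewrite -[LHS]/(piL _).
  transitivity (piL (\sum_(c in 'C[g]%g) kGU_pure (z * c)%g (p (z * c)%g))); last first.
    by rewrite linear_sum.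
  congr (piL _); apply/ffunP => y; rewrite ffunE sum_ffunE.
  have yE : (y * g * y^-1 == z * g * z^-1)%g = ((z^-1 * y)%g \in 'C[g]%g).
    rewrite -{1 2}(mulKVg z y); move: (z^-1 * y)%g => w.
    rewrite invMg !mulgA (inj_eq (mulIg _)) -!mulgA (inj_eq (mulgI _)) mulgA.
    apply/eqP/cent1P => [E|E]; last by rewrite E mulgK.
    by rewrite /commute -{2}E mulgKV.
  have E c : (kGU_pure (z * c)%g (p (z * c)%g) y =
      if c == (z^-1 * y)%g then p y else 0).
    rewrite ffunE -(can2_eq (mulKg z) (mulKVg z)) eq_sym.
    by case: eqP => // ->.
  under [RHS]eq_bigr => c _ do rewrite E.
  rewrite /chi yE; case zyC: ((z^-1 * y)%g \in 'C[g]%g); last first.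
    rewrite scale0r big1 // => c cC; case: eqP => // cE; by rewrite cE zyC in cC.
  rewrite scale1r (bigD1 (z^-1 * y)%g) //= eqxx big1 ?addr0 // => c.
  by case/andP=> _ /negPf ->.
have Pv v : (pi (kGU_pure 1%g v) : DG_weight bH dD rG) \in P.
  have vu : (v <= cyclic_mx rG u)%MS.
    by rewrite -(mxsimple_cyclic irr u0 (submx1 _)) submx1.
  have [A /envelop_mxP[a ->] ->] := cyclic_mxP vu.
  have P0 : (pi (kGU_pure 1%g 0) : DG_weight bH dD rG) \in P.
    by rewrite -[kGU_pure _ _]/(pureL _ _) linear0 quotpi0 cP.1.
  rewrite mulmx_sumr; elim/big_rec: _ => [|c w cC Pw]; first exact: P0.
  rewrite -[kGU_pure _ _]/(pureL _ _) linearD /= quotpiD; apply: PD => //.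
  (* The scalar [a c] acts as a constant function in k^G, an element of D(G) under which [P] is
     stable. *)
  have := Pdual (fun=> a c) (pi (kGU_pure 1%g (u *m rG c))).
  rewrite wt_actE actpure.
  have -> : [ffun z => a c *: kGU_pure 1%g (u *m rG c) z] =
      kGU_pure 1%g (u *m (a c *: rG c)) :> kGU k gT n.
    apply/ffunP => z; rewrite !ffunE -scalemxAr.
    by case: eqP; rewrite // scaler0.
  apply; rewrite -[c in rG c]invgK -pi_pure_cent ?groupV // mul1g.
  by have := Ptrans c^-1%g _ _ Pu; rewrite mulg1.
move=> y _; rewrite -[y](quotreprK (cP := gensub_submod (kGU_rel rG))).
rewrite (kGU_sum (quotrepr y)) -[X in X \in P]/(piL _) linear_sum.
apply: (big_ind (fun q => (q : DG_weight bH dD rG) \in P)) => [||z _].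
- exact: cP.1.
- exact: PD.
by have := Ptrans z _ _ (Pv (quotrepr y z)); rewrite mulg1.
Qed.

End WeightModules.

(** * Verma modules *)

Section Verma.
Variables (k : fieldType) (gT : finGroupType) (V : vectType k) (YV : ydMod gT V).
Variables (B : falgType k) (NB : nichols YV B).
Variables (H : falgType k) (hH : hopf H) (bH : bosonization NB hH).
Variables (D : falgType k) (dD : drinfeldDouble hH D).
Local Notation Hd := 'Hom(H, k^o).
Local Notation deg := (ndeg NB).
Local Notation grp := (bos_grp bH).
Local Notation alg := (bos_alg bH).
Local Notation DG := (subvs_of (subalg (DG_gens bH dD))).
Variables (g : gT) (n : nat) (rG : mx_representation k 'C[g]%g n).
Local Notation U := 'rV[k]_n.
Local Notation pi := (quotpi (gensub_submod (kGU_rel rG))).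

Lemma dd_grp_DG (z : D) : z \in subalg (DG_gens bH dD) ->
  exists F, z = dd_grp bH dD F.
Proof.
move=> zG; exists ((linfun (dd_grp bH dD))^-1%VF z).
by rewrite (subalg_dd_grp (bH := bH) (@DG_gens_dd_grp _ _ _ _ _ _ _ _ bH _ dD)).
Qed.

(* A space of vectors on which kG and H^* act as on 1 (x) U in M(g,rho) extends
   to a map out of M(g,rho). *)
Lemma wt_lift_ex (N : lmodType D) (phi : U -> N) :
  (forall a u v, phi (a *: u + v) = (a%:A : D) *: phi u + phi v) ->
  (forall c u, c \in 'C[g]%g -> dd_alg dD (grp c) *: phi u = phi (u *m rG c^-1%g)) ->
  (forall (f : Hd) u, dd_dual dD f *: phi u = phi ((f (grp g) : k) *: u)) ->
  exists Phi : kGCU rG -> N,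
    [/\ forall m m', Phi (m + m') = Phi m + Phi m',
        forall F m, dd_grp bH dD F *: Phi m = Phi (wt_act bH F m) &
        forall u, Phi (pi (kGU_pure 1%g u)) = phi u].
Proof.
move=> phiP phiC phif.
have phi0 : phi 0 = 0.
  by have := phiP (-1) 0 0; rewrite scaler0 addr0 scaleN1r scaleN1r addNr.
pose Phi0 (p : kGU k gT n) : N := \sum_y dd_alg dD (grp y) *: phi (p y).
have Phi0P a p q : Phi0 (a *: p + q) = (a%:A : D) *: Phi0 p + Phi0 q.
  rewrite scaler_sumr -big_split; apply: eq_bigr => y _ /=.
  by rewrite !ffunE phiP scalerDr !scalerA -scalerAl -scalerAr mul1r mulr1.
have Phi0_pure y u : Phi0 (kGU_pure y u) = dd_alg dD (grp y) *: phi u.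
  rewrite /Phi0 (bigD1 y) //= ffunE eqxx big1 ?addr0 // => z /negPf zy.
  by rewrite ffunE zy phi0 scaler0.
have Phi0_rel p : p \in gensub (kGU_rel rG) -> Phi0 p = 0.
  suff sub : {subset gensub (kGU_rel rG) <= [pred p | Phi0 p == 0]}.
    by move=> /sub; rewrite inE => /eqP.
  apply: gensubP => [|_ [y [c [u [cC ->]]]]].
    split=> [|a q r]; rewrite !inE.
      by rewrite /Phi0 big1 // => y _; rewrite ffunE phi0 scaler0.
    by move=> /eqP q0 /eqP r0; rewrite Phi0P q0 r0 scaler0 addr0.
  rewrite inE addrC -scaleN1r Phi0P !Phi0_pure -phiC // !scalerA.
  by rewrite scaleN1r !mulNr !mul1r scaleNr dd_alg_grpr -bos_grpM addNr.
have Phi0_act F p : dd_grp bH dD F *: Phi0 p = Phi0 (kGU_act bH g F p).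
  have phiS (I : finType) (v : I -> U) : phi (\sum_i v i) = \sum_i phi (v i).
    apply: (big_morph phi _ phi0) => u w.
    by rewrite -[u]scale1r phiP !scale1r.
  rewrite scaler_sumr.
  transitivity (\sum_y \sum_x dd_alg dD (grp (x * y)%g) *:
      phi ((F x (grp (y * g * y^-1)%g) : k) *: p y)).
    apply: eq_bigr => y _; rewrite scalerA mulr_suml scaler_suml.
    apply: eq_bigr => x _; rewrite [dd_alg dD (grp y)]/dd_alg ddM_grpr.
    rewrite -bos_grpM (dd_split bH) -scalerA phif /grp_twist dual_mul1l dual_hitE.
    by rewrite -!bos_grpM.
  rewrite exchange_big /=.
  transitivity (\sum_x \sum_z dd_alg dD (grp z) *:
      phi ((F x (grp (x^-1 * z * g * z^-1 * x)%g) : k) *: p (x^-1 * z)%g)).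
    apply: eq_bigr => x _; rewrite [RHS](reindex_inj (mulgI x)) /=.
    apply: eq_bigr => y _; rewrite !invMg !mulgA mulVg mul1g mulgKV.
    by [].
  rewrite exchange_big /=; apply: eq_bigr => z _.
  by rewrite ffunE phiS scaler_sumr.
pose Phi (m : kGCU rG) := Phi0 (quotrepr m).
have PhiE p : Phi (pi p) = Phi0 p.
  apply/eqP; rewrite -subr_eq0 -scaleN1r addrC.
  have -> : (-1 : D) = (-1 : k)%:A by rewrite scaleN1r.
  rewrite -Phi0P scaleN1r addrC Phi0_rel //.
  by apply/(quotpiP (gensub_submod (kGU_rel rG))); rewrite quotreprK.
exists Phi; split=> [m m'|F m|u].
- rewrite -[m]quotreprK -[m']quotreprK -quotpiD !PhiE.
  by rewrite -[X in Phi0 (X + _)]scale1r Phi0P !scale1r.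
- by rewrite -[m]quotreprK wt_actE !PhiE.
by rewrite PhiE Phi0_pure bos_grp1 [dd_alg dD 1](dd1 dD) scale1r.
Qed.

Local Notation verma := (verma bH dD rG).

Definition vtens (d : D) (m : kGCU rG) : verma :=
  @ind_tens _ _ (subalg_val (X := Dge0_gens bH dD)) (Dge0_weight bH dD rG) d m.

(** Every [F] may cross the tensor sign because [dd_grp_Dge0] places kG (x) H^* inside D^{>= 0}. *)
Lemma vtens_act d F m : vtens (d * dd_grp bH dD F) m = vtens d (wt_act bH F m).
Proof.
pose a : subvs_of (subalg (Dge0_gens bH dD)) := Subvs (dd_grp_Dge0 bH dD F).
apply: etrans (@ind_tensA _ _ (subalg_val (X := Dge0_gens bH dD))
  (Dge0_weight bH dD rG) d a m) _.
by congr (ind_tens _ _ _); apply: Mgr_wt_act.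
Qed.

Lemma vtensDl d e m : vtens (d + e) m = vtens d m + vtens e m.
Proof. exact: ind_tensDl. Qed.

Lemma vtensDr d m m' : vtens d (m + m') = vtens d m + vtens d m'.
Proof. exact: ind_tensDr. Qed.

Lemma vtensZ d e m : d *: vtens e m = vtens (d * e) m.
Proof. exact: ind_tensZ. Qed.

Lemma vtens0r d : vtens d 0 = 0.
Proof. by apply: (addrI (vtens d 0)); rewrite -vtensDr !addr0. Qed.

Lemma vtens0l m : vtens 0 m = 0.
Proof. by have := vtensZ 0 0 m; rewrite mul0r scale0r. Qed.

Lemma verma_ind (Q : verma -> Prop) : Q 0 -> (forall x y, Q x -> Q y -> Q (x + y)) ->
  (forall i b m, b \in deg i -> Q (vtens (dd_alg dD (alg b)) m)) -> forall x, Q x.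
Proof.
move=> Q0 QD Qp; apply: induce_ind => // d m.
move: d m; suff: forall d m, Q (vtens d m) by [].
apply: (dd_ind (bH := bH) (dD := dD)) => [d e Qd Qe m|b F m].
  by rewrite vtensDl; apply: QD.
rewrite vtens_act; move: (wt_act _ _ _) => {m} m.
move: b; apply: (@ndeg_ind _ _ _ _ _ NB) => [|a b Qa Qb|i b /Qp]; last exact.
  by rewrite !linear0 vtens0l.
by rewrite !linearD /= vtensDl; apply: QD.
Qed.

Lemma verma_lift_ex (N : lmodType D) (Phi : kGCU rG -> N) :
  (forall m m', Phi (m + m') = Phi m + Phi m') ->
  (forall F m, dd_grp bH dD F *: Phi m = Phi (wt_act bH F m)) ->
  exists f : {linear verma -> N}, forall d m, f (vtens d m) = d *: Phi m.
Proof.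
move=> PhiD PhiA; apply: ind_lift_ex => // a m.
have [F aF] := subalg_ex (@Dge0_gens_dd_grp _ _ _ _ _ _ _ _ bH _ dD) a.
by rewrite [a *: m](Mgr_wt_act _ aF) -PhiA -aF.
Qed.

(** Compatibility with the tensor product over D^{>= 0} is the right linearity [dd_top_coefMr] of
    the projection. *)
Lemma verma_top_ex : exists p : {additive verma -> kGCU rG},
  forall d m, p (vtens d m) = wt_act bH (dd_top_coef bH dD d) m.
Proof.
have bDl d e m : wt_act bH (dd_top_coef bH dD (d + e)) m =
    wt_act bH (dd_top_coef bH dD d) m + wt_act bH (dd_top_coef bH dD e) m :> kGCU rG.
  by rewrite dd_top_coefD wt_act_addl.
have bDr d (m m' : kGCU rG) : wt_act bH (dd_top_coef bH dD d) (m + m') =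
    wt_act bH (dd_top_coef bH dD d) m + wt_act bH (dd_top_coef bH dD d) m'.
  exact: wt_act_addr.
have bA d F (m : kGCU rG) : wt_act bH (dd_top_coef bH dD (d * dd_grp bH dD F)) m =
    wt_act bH (dd_top_coef bH dD d) (wt_act bH F m).
  by rewrite dd_top_coefMr wt_actM.
pose beta d (m : Dge0_weight bH dD rG) : kGCU rG := wt_act bH (dd_top_coef bH dD d) m.
apply: (@ind_pairing_ex _ _ (subalg_val (X := Dge0_gens bH dD)) _ _ beta).
- exact: bDl.
- exact: bDr.
move=> d a m; have [F aF] := subalg_ex (@Dge0_gens_dd_grp _ _ _ _ _ _ _ _ bH _ dD) a.
by rewrite (Mgr_wt_act m aF); apply: etrans (bA d F m); rewrite -aF.
Qed.

Definition verma_top : {additive verma -> kGCU rG} := sval (cid verma_top_ex).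

Lemma verma_topE d m : verma_top (vtens d m) = wt_act bH (dd_top_coef bH dD d) m.
Proof. by rewrite /verma_top; case: cid. Qed.

Lemma verma_top1 m : verma_top (vtens 1 m) = m.
Proof.
by rewrite verma_topE -(dd_grp1 bH dD) dd_top_coef_grp wt_act1.
Qed.

Lemma verma_top_alg b x :
  verma_top (dd_alg dD (alg b) *: x) = (ncou NB b : k) *: verma_top x.
Proof.
move: x; apply: verma_ind => [|x y Px Py|i c m _].
- by rewrite scaler0 raddf0 scaler0.
- by rewrite scalerDr !raddfD /= Px Py.
by rewrite vtensZ !verma_topE dd_top_coefMalg wt_actZl.
Qed.

Lemma verma_top_DG F x : dd_grp bH dD F \in subalg (DG_gens bH dD) ->
  verma_top (dd_grp bH dD F *: x) = wt_act bH F (verma_top x).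
Proof.
move=> FG; move: x; apply: verma_ind => [|x y Px Py|i c m _].
- by rewrite scaler0 raddf0 wt_act0r.
- by rewrite scalerDr !raddfD /= Px Py wt_act_addr.
by rewrite vtensZ !verma_topE dd_top_coef_DG // wt_actM.
Qed.

Hypothesis simpleM : simple_module (DG_weight bH dD rG).

(** The image of a D-submodule under the projection is a D(G)-submodule of the simple module
    M(g,rho). *)
Lemma verma_top_submod (P : {pred verma}) x : submod_closed P -> x \in P ->
  verma_top x != 0 -> forall m, exists2 y, y \in P & verma_top y = m.
Proof.
move=> cP Px px0 m.
pose I : {pred DG_weight bH dD rG} :=
  fun m => `[< exists2 y, y \in P & verma_top y = m >].
have cI : submod_closed I.
  split=> [|a u v /asboolP[y Py <-] /asboolP[z Pz <-]]; apply/asboolP.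
    by exists 0; rewrite ?raddf0 // cP.1.
  have [F aF] := dd_grp_DG (subvsP a).
  exists (vsval a *: y + z); first exact: cP.2.
  rewrite raddfD /= (Mgr_wt_act _ aF) aF verma_top_DG // -aF.
  exact: subvsP.
have [_ _ sM] := simpleM; have [] := sM _ cI (fun _ _ => isT).
  move=> /(_ (verma_top x)) E; case/eqP: px0; apply: E.
  by apply/asboolP; exists x.
by move=> /(_ m isT) /asboolP.
Qed.

(* Nakayama's argument: B^{>0} is nilpotent, and modulo B^{>0} M the Verma module
   M is the simple D(G)-module M(g,rho). *)
Lemma verma_proper (P : {pred verma}) x : submod_closed P -> x \in P ->
  verma_top x != 0 -> forall y, y \in P.
Proof.
move=> cP Px px0.
have PD := submodD cP; have PB := submodB cP; have PZ a := submodZ a cP.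
have lift := verma_top_submod cP Px px0.
have [N hiN] := ndeg_high NB.
(* Descending induction on the degree [j]: [i] bounds its distance to [N], from where on [B] is
   zero. *)
have low i j b m : (N <= i + j)%N -> b \in deg j -> vtens (dd_alg dD (alg b)) m \in P.
  elim: i j b m => [|i IH] j b m.
    rewrite add0n => Nj /(hiN _ _ Nj) ->; rewrite !linear0 vtens0l; exact: cP.1.
  rewrite addSnnS => Nij bj.
  have [y Py pym] := lift m.
  (* Lift [m] to [y] in [P]. The difference of [y] and its top part lies in B^{>0} M, so multiplying
     it by [b] gives terms of degree above [j]. *)
  have -> : vtens (dd_alg dD (alg b)) m =
      dd_alg dD (alg b) *: y - dd_alg dD (alg b) *: (y - vtens 1 (verma_top y)).
    by rewrite -scalerBr opprB addrC subrK vtensZ mulr1 pym.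
  apply: PB; first exact: PZ.
  move: y {Py pym}; apply: verma_ind => [|y z Qy Qz|l c w cl].
  - by rewrite (raddf0 verma_top) vtens0r subr0 scaler0 cP.1.
  - by rewrite (raddfD verma_top) vtensDr opprD addrACA scalerDr; apply: PD.
  rewrite verma_topE; have [l0|l0] := eqVneq l 0%N.
    (* A degree 0 component equals its own top part and contributes nothing. *)
    move: cl; rewrite l0 ndeg0 => /vlineP[a ->].
    have -> : dd_alg dD (alg a%:A) = dd_grp bH dD (dd_single 1%g (a *: hcou hH)).
      rewrite linearZ /= rmorph1 linearZ /= [dd_alg dD 1](dd1 dD) -(dd_grp1 bH dD).
      have <- : dd_grp bH dD (a *: dd_single 1%g (hcou hH)) =
        a *: dd_grp bH dD (dd_single 1%g (hcou hH)) by rewrite linearZ.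
      congr dd_grp; apply/ffunP => y; rewrite !ffunE.
      by case: eqP; rewrite ?scaler0.
    rewrite -[dd_grp _ _ _]mul1r vtens_act.
    rewrite mul1r dd_top_coef_grp.
    by rewrite subrr scaler0 cP.1.
  rewrite -{2}[dd_alg dD (alg c)]mulr1 dd_top_coefMalg (ndeg_cou cl) ?lt0n //.
  rewrite wt_actZl scale0r.
  rewrite vtens0r subr0 vtensZ dd_algM -rmorphM; apply: (IH (j + l)%N); last exact: ndegM.
  by rewrite (leq_trans Nij) // leq_add2l -addn1 leq_add2l lt0n.
move=> y; move: y; apply: verma_ind => [||i b m bi]; first exact: cP.1.
  by move=> y z; apply: PD.
by apply: (low N i) => //; apply: leq_addr.
Qed.

End Verma.

(** * Heads of Verma modules *)

(** The head is a quotient by [module_rad], which coincides with [verma_max] only extensionally;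
    maximality has to be transported. *)
Lemma maximal_sub_eqi (R : nzRingType) (N : lmodType R) (P Q : {pred N}) :
  P =i Q -> submod_closed P -> maximal_sub Q -> maximal_sub P.
Proof.
move=> PQ cP [_ [x Qx] maxQ]; split=> //; first by exists x; rewrite PQ.
move=> T cT PT; have [|TQ|TT] := maxQ T cT; [|left|right] => //.
  by move=> y; rewrite -PQ; apply: PT.
by move=> y /TQ; rewrite PQ.
Qed.

Section VermaHead.
Variables (k : fieldType) (gT : finGroupType) (V : vectType k) (YV : ydMod gT V).
Variables (B : falgType k) (NB : nichols YV B).
Variables (H : falgType k) (hH : hopf H) (bH : bosonization NB hH).
Variables (D : falgType k) (dD : drinfeldDouble hH D).
Local Notation Hd := 'Hom(H, k^o).
Local Notation grp := (bos_grp bH).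
Local Notation alg := (bos_alg bH).
Hypothesis char0 : [pchar k] =i pred0.

Section Head.
Variables (g : gT) (n : nat) (rG : mx_representation k 'C[g]%g n).
Hypothesis irr : mx_irreducible rG.
Local Notation verma := (verma bH dD rG).
Local Notation head := (verma_head bH dD rG).
Local Notation top := (verma_top bH dD rG).
Local Notation vtens := (vtens bH dD (rG := rG)).
Local Notation hpi := (quotpi (@module_rad_submod _ verma)).

Let simpleM : simple_module (DG_weight bH dD rG) := DG_weight_simple bH dD char0 irr.

Lemma wt_act_Vbar y (m : kGCU rG) : in_Vbar bH y ->
  wt_act bH (dd_single 1%g y) m = 0.
Proof.
move=> yV; have gy : Dge0_gens bH dD (dd_dual dD y) by right; exists y.
pose a : subvs_of (subalg (Dge0_gens bH dD)) := Subvs (subalg_gen gy).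
have <- : a *: (m : Dge0_weight bH dD rG) = wt_act bH (dd_single 1%g y) m.
  by apply: Mgr_wt_act; rewrite -dd_dualE.
exact: (Mgr_Vbar _ yV).
Qed.

(** Quantifying over [d] makes this the largest D-submodule in the kernel of [top]. *)
Definition verma_max : {pred verma} := fun x => `[< forall d : D, top (d *: x) = 0 >].

Lemma verma_max_submod : submod_closed verma_max.
Proof.
split=> [|a x y /asboolP Xx /asboolP Xy]; apply/asboolP => d.
  by rewrite scaler0 raddf0.
by rewrite scalerDr scalerA raddfD /= Xx Xy addr0.
Qed.

Lemma verma_max_top x : x \in verma_max -> top x = 0.
Proof. by move=> /asboolP/(_ 1); rewrite scale1r. Qed.

Lemma verma_max_or (P : {pred verma}) : submod_closed P ->
  {subset P <= verma_max} \/ forall x, x \in P.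
Proof.
move=> cP; have [/asboolP[x Px px0]|/asboolPn nP] :=
    boolP `[< exists2 x, x \in P & top x != 0 >].
  by right; apply: (verma_proper simpleM cP Px px0).
left=> x Px; apply/asboolP => d; apply: contrapT => /eqP dx0; apply: nP.
by exists (d *: x) => //; apply: submodZ.
Qed.

Lemma verma_max_proper : exists x, x \notin verma_max.
Proof.
have [_ [m _ m0] _] := simpleM; exists (vtens 1 m).
by apply: contra m0 => /verma_max_top; rewrite verma_top1 => ->.
Qed.

Lemma verma_max_maximal : maximal_sub verma_max.
Proof.
split; [exact: verma_max_submod|exact: verma_max_proper|].
by move=> P cP _; apply: verma_max_or.
Qed.

Lemma verma_max_unique (P : {pred verma}) : maximal_sub P -> P =i verma_max.
Proof.
case=> cP [x Px] maxP; have [sub|PT] := verma_max_or cP; last by rewrite PT in Px.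
have [sub'|XT] := maxP _ verma_max_submod sub.
  by move=> y; apply/idP/idP => [/sub|/sub'].
by have [y] := verma_max_proper; rewrite XT.
Qed.

Lemma verma_radE : @module_rad _ verma =i verma_max.
Proof. exact: (module_rad_unique verma_max_maximal verma_max_unique). Qed.

Lemma verma_head_simple : simple_module head.
Proof.
apply: simple_quot; apply: maximal_sub_eqi verma_max_maximal.
  exact: verma_radE.
exact: module_rad_submod.
Qed.

Lemma hpi_linear : linear hpi. Proof. exact: quotpi_linear. Qed.

Lemma hpiZ d x : hpi (d *: x) = d *: hpi x.
Proof. by rewrite -[d *: x]addr0 hpi_linear quotpi0 addr0. Qed.

(** The projection descends because the radical lies in its kernel. It recovers M(g,rho) from the
    head. *)
Definition head_top (y : head) : kGCU rG := top (quotrepr y).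

Lemma head_topE x : head_top (hpi x) = top x.
Proof.
apply/eqP; rewrite -subr_eq0 -raddfB; apply/eqP/verma_max_top.
rewrite -verma_radE; apply/(quotpiP (@module_rad_submod _ verma)).
by rewrite quotreprK.
Qed.

Lemma head_topD y z : head_top (y + z) = head_top y + head_top z.
Proof.
rewrite -[y](quotreprK (cP := @module_rad_submod _ verma)).
rewrite -[z](quotreprK (cP := @module_rad_submod _ verma)).
by rewrite -quotpiD !head_topE raddfD.
Qed.

Lemma head_top_alg b y :
  head_top (dd_alg dD (alg b) *: y) = (ncou NB b : k) *: head_top y.
Proof.
rewrite -[y](quotreprK (cP := @module_rad_submod _ verma)).
by rewrite -hpiZ !head_topE verma_top_alg.
Qed.

Lemma head_top_DG F y : dd_grp bH dD F \in subalg (DG_gens bH dD) ->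
  head_top (dd_grp bH dD F *: y) = wt_act bH F (head_top y).
Proof.
move=> FG; rewrite -[y](quotreprK (cP := @module_rad_submod _ verma)).
by rewrite -hpiZ !head_topE verma_top_DG.
Qed.

Definition head_weight (m : kGCU rG) : head := hpi (vtens 1 m).

Lemma head_weight_act F m :
  head_weight (wt_act bH F m) = dd_grp bH dD F *: head_weight m.
Proof. by rewrite /head_weight -vtens_act -hpiZ vtensZ mulr1 mul1r. Qed.

Lemma head_weightD m m' : head_weight (m + m') = head_weight m + head_weight m'.
Proof. by rewrite /head_weight vtensDr quotpiD. Qed.

Lemma head_top_weight m : head_top (head_weight m) = m.
Proof. by rewrite head_topE verma_top1. Qed.

Lemma head_ind (Q : head -> Prop) : Q 0 -> (forall x y, Q x -> Q y -> Q (x + y)) ->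
  (forall b m, Q (dd_alg dD (alg b) *: head_weight m)) -> forall y, Q y.
Proof.
move=> Q0 QD Qp y; rewrite -[y](quotreprK (cP := @module_rad_submod _ verma)).
move: (quotrepr y) => {y} x; move: x; apply: verma_ind => [|x y Qx Qy|i b m _].
- by rewrite quotpi0.
- by rewrite quotpiD; apply: QD.
by have := Qp b m; rewrite /head_weight -hpiZ vtensZ mulr1.
Qed.

Lemma verma_head_highest_weight : highest_weight bH dD rG head.
Proof.
pose hw : DG_weight bH dD rG -> restr_along (subalg_val (X := DG_gens bH dD)) head :=
  head_weight.
have lin : linear hw.
  move=> a u v; have [F aF] := dd_grp_DG (subvsP a).
  rewrite (Mgr_wt_act u aF); apply: etrans (head_weightD _ _) _.
  by rewrite head_weight_act -aF.
have inj : injective (mk_linear lin).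
  by apply: (can_inj (g := head_top)) => m; apply: head_top_weight.
pose M : {pred restr_along (subalg_val (X := DG_gens bH dD)) head} :=
  fun x => `[< exists m, mk_linear lin m = x >].
have MP x : x \in M <-> exists m, mk_linear lin m = x by split=> /asboolP.
exists M; split.
- exact: (simple_sub_image simpleM inj MP).
- by exists (mk_linear lin).
- move=> y x yV /MP[m <-]; rewrite (dd_dualE bH).
  apply: etrans (esym (head_weight_act _ _)) _.
  rewrite wt_act_Vbar //; apply: (addrI (head_weight 0)).
  by rewrite -head_weightD !addr0.
move=> P cP MsubP; apply: head_ind => [|x y Px Py|b m]; first exact: cP.1.
  exact: submodD.
by apply: submodZ => //; apply: MsubP; apply/MP; exists m.
Qed.

(** The map extends to the Verma module; being nonzero with simple target, it is onto with maximal
    kernel, and that kernel is the unique maximal submodule. *)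
Lemma simple_iso_head (N : lmodType D) (Phi : kGCU rG -> N) m0 :
  simple_module N ->
  (forall m m', Phi (m + m') = Phi m + Phi m') ->
  (forall F m, dd_grp bH dD F *: Phi m = Phi (wt_act bH F m)) ->
  Phi m0 != 0 -> lmod_iso N head.
Proof.
move=> sN PhiD PhiA Phi0; have [f fE] := verma_lift_ex PhiD PhiA.
apply: (head_iso (f := f) (x0 := vtens 1 m0) sN _ verma_max_unique).
by rewrite fE scale1r.
Qed.

Lemma highest_weight_iso_head (N : lmodType D) :
  simple_module N -> highest_weight bH dD rG N -> lmod_iso N head.
Proof.
move=> sN [M [_ [f inj fM] VM _]]; have [_ [m0 _ m0N0] _] := simpleM.
pose Phi (m : kGCU rG) : N := f m.
have PhiD m m' : Phi (m + m') = Phi m + Phi m' by apply: (raddfD f).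
have PhiP a m m' : Phi (a *: m + m') = (a%:A : D) *: Phi m + Phi m'.
  rewrite PhiD; congr (_ + _).
  have ->: a *: m = wt_act bH (a *: dd_single 1%g (hcou hH)) m.
    by rewrite wt_actZl wt_act1.
  have aF : a%:A = dd_grp bH dD (a *: dd_single 1%g (hcou hH)).
    by rewrite linearZ /= dd_grp1.
  have aG : a%:A \in subalg (DG_gens bH dD) by rewrite memvZ ?subalg1.
  rewrite -(Mgr_wt_act (hX := DG_gens_dd_grp (dD := dD)) (a := Subvs aG) m aF).
  by rewrite /Phi linearZ.
apply: (simple_iso_head (Phi := Phi) (m0 := m0) sN PhiD); last first.
  by rewrite /Phi raddf_eq0.
(* Equivariance is known on generators only: for D(G) by linearity of [f], for \overline V since
   both sides are zero. It spreads over D^{>= 0}, hence to every [dd_grp F]. *)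
suff H0 d : d \in subalg (Dge0_gens bH dD) ->
    exists2 F, d = dd_grp bH dD F & forall m, d *: Phi m = Phi (wt_act bH F m).
  move=> F m; have [F' FF' ->] := H0 _ (dd_grp_Dge0 bH dD F).
  by rewrite (can_inj (dd_grpK bH dD) FF').
move: d; apply: subalg_ind => [a x y [F -> Fx] [G -> Gy]|||u x Xu [F -> Fx]].
- exists (a *: F + G) => [|m]; first by rewrite linearP.
  by rewrite wt_actDl PhiP scalerDl -Fx -Gy scalerA -scalerAl mul1r.
- exists 0 => [|m]; first by rewrite linear0.
  by rewrite scale0r wt_act0l /Phi linear0.
- exists (dd_single 1%g (hcou hH)) => [|m]; first by rewrite dd_grp1.
  by rewrite scale1r wt_act1.
have [G uG uP] : exists2 G, u = dd_grp bH dD G &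
    forall m, u *: Phi m = Phi (wt_act bH G m).
  case: Xu => [Gu|[y yV ->]].
    have [G uG] := DG_gens_dd_grp Gu; exists G => // m.
    pose a : subvs_of (subalg (DG_gens bH dD)) := Subvs (subalg_gen Gu).
    by rewrite -(Mgr_wt_act (hX := DG_gens_dd_grp (dD := dD)) (a := a) m uG) /Phi linearZ.
  exists (dd_single 1%g y) => [|m]; first by rewrite -dd_dualE.
  rewrite VM //; last by apply/fM; exists m.
  by rewrite wt_act_Vbar // /Phi linear0.
exists (grp_mul bH G F) => [|m]; first by rewrite uG dd_grpM.
by rewrite -scalerA Fx uP wt_actM.
Qed.

End Head.

(** The isomorphism of heads is sandwiched between M(g,rho) -> L and L' -> M(g',rho'). The composite
    is D(G)-linear, so Schur's lemma needs only that it is nonzero. *)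
Lemma head_iso_weight (g g' : gT) n n' (rG : mx_representation k 'C[g]%g n)
    (rG' : mx_representation k 'C[g']%g n') :
  mx_irreducible rG -> mx_irreducible rG' ->
  lmod_iso (verma_head bH dD rG) (verma_head bH dD rG') ->
  lmod_iso (DG_weight bH dD rG) (DG_weight bH dD rG').
Proof.
move=> irr irr' [th [th' thK th'K]].
pose h (m : DG_weight bH dD rG) : DG_weight bH dD rG' := head_top (th (head_weight m)).
have lin : linear h.
  move=> a u v; have [F aF] := dd_grp_DG (subvsP a).
  rewrite (Mgr_wt_act u aF) (Mgr_wt_act (h u) aF).
  rewrite /h [head_weight _]head_weightD head_weight_act linearD linearZ.
  by rewrite head_topD // head_top_DG // -aF subvsP.
have [m0 hm0] : exists m0, h m0 != 0.
  apply: contrapT => nh; have h0 m : h m = 0.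
    by apply: contrapT => /eqP hm; apply: nh; exists m.
  (* A zero composite would make [head_top] vanish on all images of b m, which span the head, hence
     on the whole target of the surjective [th]. *)
  have all0 y : head_top (th y) = 0.
    move: y; apply: head_ind => [|x y Qx Qy|b m].
    - rewrite linear0; have := head_topD irr' 0 0; rewrite addr0 => /esym E.
      by apply: (addrI (head_top 0)); rewrite E addr0.
    - by rewrite linearD head_topD // Qx Qy addr0.
    by rewrite linearZ head_top_alg // [head_top _]h0 scaler0.
  have [_ [m _ m0N0] _] := DG_weight_simple bH dD char0 irr'.
  case/eqP: m0N0; rewrite -[m](head_top_weight irr') -[head_weight m]th'K.
  exact: all0.
exists (mk_linear lin); apply: (schur (x0 := m0)) => //; exact: DG_weight_simple.
Qed.

End VermaHead.

(** * Highest-weight vectors in simple modules *)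

Section SimpleModules.
Variables (k : fieldType) (gT : finGroupType) (V : vectType k) (YV : ydMod gT V).
Variables (B : falgType k) (NB : nichols YV B).
Variables (H : falgType k) (hH : hopf H) (bH : bosonization NB hH).
Variables (D : falgType k) (dD : drinfeldDouble hH D).
Local Notation Hd := 'Hom(H, k^o).
Local Notation grp := (bos_grp bH).
Local Notation alg := (bos_alg bH).

Lemma highest_vector_ex (N : lmodType D) (x : N) : x != 0 ->
  exists2 w : N, w != 0 &
    forall f : Hd, (forall g, f (grp g) = 0) -> dd_dual dD f *: w = 0.
Proof.
move=> x0; apply: contrapT => now.
have step (w : N) : w != 0 -> exists2 f : Hd, (forall g, f (grp g) = 0) &
    dd_dual dD f *: w != 0.
  move=> w0; apply: contrapT => nf; apply: now; exists w => // f f0.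
  by apply: contrapT => /eqP fw; apply: nf; exists f.
have all_n n : exists2 f : Hd, bos_low_zero bH n f & dd_dual dD f *: x != 0.
  elim: n => [|n [f fn fx]].
    by exists (hcou hH) => //; rewrite [dd_dual _ _](dd1 dD) scale1r.
  have [f' f'0 f'x] := step _ fx; exists (dual_mul hH f f').
    exact: bos_low_zero_mul.
  by rewrite -(dd_dualM bH) -scalerA.
have [n hin] := bos_low_zero_all bH; have [f /hin ->] := all_n n.
by rewrite linear0 scale0r eqxx.
Qed.

(** The indicator functions e_g sum to 1, so some e_g w is nonzero. The product of [f] and e_g
    differs from f(g) e_g by a functional vanishing on kG, which kills [w]. *)
Lemma weight_vector_ex (N : lmodType D) (x : N) : x != 0 ->
  exists (g : gT) (w : N), w != 0 /\
    forall f : Hd, dd_dual dD f *: w = ((f (grp g) : k)%:A : D) *: w.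
Proof.
move=> /highest_vector_ex[w w0 wI].
pose e g := dual_grp bH (fun y => (y == g)%:R).
have [g gw] : exists g, dd_dual dD (e g) *: w != 0.
  apply: contrapT => ng; case/eqP: w0; rewrite -[w]scale1r -(dd1 dD) -/(dd_dual dD _).
  have -> : hcou hH = \sum_g e g.
    apply: (bos_fun_ext (bH := bH)) => b y; rewrite hcouM bos_cou_alg bos_cou_grp.
    rewrite [RHS]sum_lfunE (bigD1 y) //= bos_funE eqxx scale1r big1 ?addr0 ?mulr1 //.
    by move=> z /negPf zy; rewrite bos_funE eq_sym zy scale0r zero_lfunE.
  rewrite linear_sum scaler_suml big1 // => g _.
  by apply: contrapT => /eqP gw; apply: ng; exists g.
exists g, (dd_dual dD (e g) *: w); split=> // f.
apply/eqP; rewrite -subr_eq0 !scalerA (dd_dualM bH) -scalerAl mul1r.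
have -> : f (grp g) *: dd_dual dD (e g) = dd_dual dD ((f (grp g) : k) *: e g).
  by rewrite linearZ.
have subE (u v : Hd) : dd_dual dD u - dd_dual dD v = dd_dual dD (u - v).
  by rewrite addrC -scaleN1r -dd_dual_is_linear scaleN1r addrC.
rewrite -scalerBl subE wI // => y.
rewrite add_lfunE opp_lfunE scale_lfunE dual_mul_grpl dual_grpE.
by case: eqP => [->|_]; rewrite ?mul1r ?mul0r /GRing.scale /= ?mulr1 ?mulr0 subrr.
Qed.

(* Among the submodules of the regular representation of C_g that act nontrivially
   on w, one of least dimension is irreducible by Maschke's theorem. *)
Lemma weight_space_ex (N : lmodType D) (g : gT) (w : N) :
  [pchar k] =i pred0 -> w != 0 ->
  (forall f : Hd, dd_dual dD f *: w = ((f (grp g) : k)%:A : D) *: w) ->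
  exists (n : nat) (rG : mx_representation k 'C[g]%g n) (phi : 'rV[k]_n -> N),
    [/\ mx_irreducible rG, exists u, phi u != 0,
        forall a u v, phi (a *: u + v) = (a%:A : D) *: phi u + phi v,
        forall c u, c \in 'C[g]%g -> dd_alg dD (grp c) *: phi u = phi (u *m rG c^-1%g) &
        forall (f : Hd) u, dd_dual dD f *: phi u = phi ((f (grp g) : k) *: u)].
Proof.
move=> char0 w0 wP; pose C := 'C[g]%G; pose R := regular_repr k C.
(* The inverse converts the right action on row vectors into the left action on [N]. *)
pose psi (u : 'rV[k]_#|C|) : N :=
  \sum_i ((u 0 i)%:A : D) *: (dd_alg dD (grp (enum_val i)^-1%g) *: w).
have central d a (z : N) : d *: ((a%:A : D) *: z) = (a%:A : D) *: (d *: z).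
  by rewrite !scalerA -scalerAr mulr1 -scalerAl mul1r.
have psiP a u v : psi (a *: u + v) = (a%:A : D) *: psi u + psi v.
  rewrite scaler_sumr -big_split; apply: eq_bigr => i _ /=.
  move: (_ *: w) => z; rewrite !mxE scalerDl scalerDl [in RHS]scalerA.
  by rewrite -scalerAl mul1r scalerA.
have psi0 : psi 0 = 0 by rewrite /psi big1 // => i _; rewrite mxE !scale0r.
have psi_delta y : y \in C ->
    psi (delta_mx 0 (gring_index C y)) = dd_alg dD (grp y^-1%g) *: w.
  move=> yC; rewrite /psi (bigD1 (gring_index C y)) //= mxE !eqxx !scale1r.
  rewrite gring_indexK // big1 ?addr0 // => i /negPf iy.
  by rewrite mxE iy andbF !scale0r.
have psiS (I : finType) (a : I -> k) (v : I -> 'rV_#|C|) :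
    psi (\sum_i a i *: v i) = \sum_i ((a i)%:A : D) *: psi (v i).
  elim/big_rec2: _ => [|i y1 y2 _ <-]; first exact: psi0.
  exact: psiP.
have psiC c u : c \in C -> dd_alg dD (grp c) *: psi u = psi (u *m R c^-1%g).
  move=> cC; rewrite mulmx_sum_row psiS scaler_sumr; apply: eq_bigr => i _.
  rewrite rowK psi_delta ?groupM ?groupV ?enum_valP // central; congr (_ *: _).
  by rewrite scalerA dd_alg_grpr -bos_grpM invMg invgK.
have psif (f : Hd) u : dd_dual dD f *: psi u = psi ((f (grp g) : k) *: u).
  have -> : psi ((f (grp g) : k) *: u) = ((f (grp g))%:A : D) *: psi u.
    by rewrite -[_ *: u]addr0 psiP psi0 addr0.
  rewrite !scaler_sumr; apply: eq_bigr => i _.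
  rewrite [LHS]central [RHS]central; congr (_ *: _).
  (* Translating by an element of the centralizer of [g] preserves the weight [g]. *)
  have : (enum_val i)^-1%g \in 'C[g]%g by rewrite groupV; apply: enum_valP.
  move: (enum_val i)^-1%g => y yC; rewrite scalerA [dd_alg _ (grp _)]/dd_alg ddM_grpr.
  rewrite mul1r (dd_split bH) -scalerA wP grp_twistE bos_cou_grp mul1r.
  by rewrite (cent1P yC) mulgK central.
pose Q r := `[< exists U : 'M[k]_#|C|, [/\ mxmodule R U, \rank U = r &
  exists2 u : 'rV_#|C|, (u <= U)%MS & psi u != 0] >].
have exQ : exists r, Q r.
  exists (\rank (1%:M : 'M[k]_#|C|)); apply/asboolP; exists 1%:M; split=> //.
    exact: mxmodule1.
  exists (delta_mx 0 (gring_index C 1%g)); first exact: submx1.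
  by rewrite psi_delta ?group1 // invg1 bos_grp1 [dd_alg _ _](dd1 dD) scale1r.
(* Minimality forces [psi] to vanish on every submodule of smaller rank. A nonzero proper submodule
   and its Maschke complement would both be such, so [psi] would vanish on [U]. *)
case: (ex_minnP exQ) => r /asboolP[U [Umod <- [u0 u0U psi_u0]]] minr.
have Usimple : mxsimple R U.
  split=> // [|W Wmod WU W0].
    apply: contra psi_u0 => /eqP U0; move: u0U; rewrite U0 submx0 => /eqP ->.
    by rewrite psi0.
  have redU : mx_completely_reducible R U.
    apply: mx_reducibleS Umod (submx1 U) _; apply: mx_Maschke_pchar.
    by rewrite /pgroup.pgroup pcharf'_nat (pcharf0P _).1 // -lt0n cardG_gt0.
  have [W' W'mod defU dx] := redU W Wmod WU.
  have small (X : 'M_#|C|) : mxmodule R X -> (\rank X < \rank U)%N ->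
      forall u : 'rV_#|C|, (u <= X)%MS -> psi u = 0.
    move=> Xmod ltXU u uX; apply: contrapT => /eqP pu.
    have : Q (\rank X) by apply/asboolP; exists X; split=> //; exists u.
    by move/minr; rewrite leqNgt ltXU.
  rewrite -mxrank_leqif_sup // eqn_leq mxrankS //= leqNgt; apply/negP => ltWU.
  have rU : \rank U = (\rank W + \rank W')%N by rewrite -defU; apply: mxdirectP dx.
  have ltW'U : (\rank W' < \rank U)%N.
    by rewrite rU -[X in (X < _)%N]add0n ltn_add2r lt0n mxrank_eq0.
  have : (u0 <= W + W')%MS by rewrite defU.
  case/sub_addsmxP=> -[a b] /= u0E.
  case/eqP: psi_u0; rewrite u0E -[a *m W]scale1r psiP.
  by rewrite (small W) ?submxMl // (small W') ?submxMl // scaler0 addr0.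
exists (\rank U), (submod_repr Umod), (fun v => psi (val_submod v)); split.
- exact/submod_mx_irr.
- by exists (in_submod U u0); rewrite in_submodK.
- by move=> a u v; rewrite linearP /= psiP.
- by move=> c u cC; rewrite psiC // val_submodJ ?groupV.
by move=> f u; rewrite psif linearZ.
Qed.

End SimpleModules.

Theorem theorem3
    (k : closedFieldType) (char0 : [pchar k] =i pred0)
    (gT : finGroupType) (nab : ~~ abelian [set: gT])
    (V : vectType k) (YV : ydMod gT V)
    (B : falgType k) (NB : nichols YV B)
    (H : falgType k) (hH : hopf H) (bH : bosonization NB hH)
    (D : falgType k) (dD : drinfeldDouble hH D) :
  (forall (g : gT) (n : nat) (rG : mx_representation k 'C[g]%g n),
     mx_irreducible rG ->
     [/\ simple_module (verma_head bH dD rG),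
         highest_weight bH dD rG (verma_head bH dD rG)
       & forall N : lmodType D,
           simple_module N -> highest_weight bH dD rG N ->
           lmod_iso N (verma_head bH dD rG)])
  /\
  (forall N : lmodType D, simple_module N ->
     exists (g : gT) (n : nat) (rG : mx_representation k 'C[g]%g n),
       [/\ mx_irreducible rG,
           lmod_iso N (verma_head bH dD rG)
         & forall (g' : gT) (n' : nat)
                  (rG' : mx_representation k 'C[g']%g n'),
             mx_irreducible rG' ->
             lmod_iso N (verma_head bH dD rG') ->
             lmod_iso (DG_weight bH dD rG') (DG_weight bH dD rG)]).
Proof.
split=> [g n rG irr|N sN].
  split; [exact: verma_head_simple|exact: verma_head_highest_weight|].
  by move=> N; apply: highest_weight_iso_head.
have [_ [x _ x0] _] := sN.
have [g [w [w0 wP]]] := weight_vector_ex bH dD x0.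
have [n [rG [phi [irr [u phiu] phiP phiC phif]]]] := weight_space_ex char0 w0 wP.
have [Phi [PhiD PhiA PhiE]] := wt_lift_ex phiP phiC phif.
have isoN : lmod_iso N (verma_head bH dD rG).
  apply: (simple_iso_head (m0 := quotpi _ (kGU_pure 1%g u)) char0 irr sN PhiD PhiA).
  by rewrite PhiE.
exists g, n, rG; split=> // g' n' rG' irr' isoN'.
apply: head_iso_weight => //; apply: lmod_iso_trans isoN.
exact: lmod_iso_sym.
Qed.
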